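(* Let $n_A,n_B\ge 1$ be integers. For every complex matrix $z\in \mathsf{M}_{n_A}\otimes\mathsf{M}_{n_B}=\mathsf{M}_{n_An_B}$, $$\|z\|_{S_1^{n_An_B}}\le 2\min\{n_A,n_B\}\,\|z\|_{S_1^{n_A}\otimes_\epsilon S_1^{n_B}}.$$ Moreover, if $z\in\mathsf{M}_{n_An_B}^{\mathrm{sa}}$ is selfadjoint, then $$\|z\|_{S_1^{n_An_B}}\le 2\sqrt{2}\,\min\{n_A,n_B\}\,\|z\|_{S_1^{n_A,\mathrm{sa}}\otimes_\epsilon S_1^{n_B,\mathrm{sa}}}.$$
   Context: $\mathsf{M}_k$ is the complex vector space of $k\times k$ complex matrices and $\mathsf{M}_k^{\mathrm{sa}}$ the real vector space of selfadjoint ones; canonically $\mathsf{M}_n\otimes\mathsf{M}_m=\mathsf{M}_{nm}$ (complex tensor product) and $\mathsf{M}_n^{\mathrm{sa}}\otimes\mathsf{M}_m^{\mathrm{sa}}=\mathsf{M}_{nm}^{\mathrm{sa}}$ (real tensor product). $S_1^k$ (resp. $S_1^{k,\mathrm{sa}}$) is $\mathsf{M}_k$ (resp. $\mathsf{M}_k^{\mathrm{sa}}$) with the trace norm $\|\cdot\|_1$, and $S_\infty^k$ (resp. $S_\infty^{k,\mathrm{sa}}$) is the same space with the operator norm $\|\cdot\|_\infty$. These are isometrically dual to each other under $\langle x,y\rangle=\operatorname{tr}(xy)$. For normed spaces $X,Y$ over the same field, the $\epsilon$ (injective) tensor norm of $z\in X\otimes Y$ is $\|z\|_{X\otimes_\epsilon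 Y}=\sup|(x^*\otimes y^* )(z)|$ over $x^*\in X^*$, $y^*\in Y^*$ with $\|x^*\|\le1$, $\|y^*\|\le 1$. Thus, concretely, $$\|z\|_{S_1^{n_A}\otimes_\epsilon S_1^{n_B}}=\sup\{|\operatorname{tr}(z\,(f\otimes g))|:\ f\in\mathsf{M}_{n_A},\ g\in\mathsf{M}_{n_B},\ \|f\|_\infty\le1,\ \|g\|_\infty\le 1\},$$ and for selfadjoint $z$, $\|z\|_{S_1^{n_A,\mathrm{sa}}\otimes_\epsilon S_1^{n_B,\mathrm{sa}}}$ is given by the same supremum restricted to selfadjoint $f\in\mathsf{M}_{n_A}^{\mathrm{sa}}$ and $g\in\mathsf{M}_{n_B}^{\mathrm{sa}}$. *)

(* Defs.v *)
From HB Require Import structures.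
From mathcomp Require Import all_boot all_order all_algebra.
From mathcomp Require Import classical_sets reals.
From mathcomp.real_closed Require Import complex mxtens.

Set Implicit Arguments.
Unset Strict Implicit.
Unset Printing Implicit Defensive.

Import GRing.Theory Num.Theory.

Local Open Scope classical_set_scope.
Local Open Scope ring_scope.
Local Open Scope sesquilinear_scope.

Section MatrixNorms.
Context {R : realType}.
Local Notation C := R[i].

(* The norm of C takes its values in C; this is the real-valued modulus. *)
Definition modulus (a : C) : R := complex.Re `|a|.

Definition l2norm {n : nat} (v : 'cV[C]_n) : R :=
  Num.sqrt (\sum_(i < n) modulus (v i 0) ^+ 2).

Definition opnorm {n : nat} (x : 'M[C]_n) : R :=
  sup [set l2norm (x *m v) | v in [set v : 'cV[C]_n | l2norm v <= 1]].

(* |x| = (x^* x)^(1/2): the square root is applied to the eigenvalues in the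
   unitary diagonalization of the positive semidefinite matrix x^* x. *)
Definition absmx {n : nat} (x : 'M[C]_n) : 'M[C]_n :=
  let h := x^t* *m x in
  invmx (spectralmx h) *m diag_mx (map_mx sqrtC (spectral_diag h))
    *m spectralmx h.

Definition trace_norm {n : nat} (x : 'M[C]_n) : R := complex.Re (\tr (absmx x)).

(* Norm of S_1^m (x)_eps S_1^n.  By the trace duality <x, y> = tr (x y), the
   dual of S_1^n is S_oo^n, so the functionals of norm at most 1 are given by
   the matrices of operator norm at most 1; [*t] is the Kronecker product,
   which realizes M_m (x) M_n = M_(m * n). *)
Definition eps_norm {m n : nat} (z : 'M[C]_(m * n)) : R :=
  sup [set modulus (\tr (z *m (f *t g))) |
        f in [set f : 'M[C]_m | opnorm f <= 1] &
        g in [set g : 'M[C]_n | opnorm g <= 1]].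

(* Norm of S_1^(m,sa) (x)_eps S_1^(n,sa), for selfadjoint z. *)
Definition eps_norm_sa {m n : nat} (z : 'M[C]_(m * n)) : R :=
  sup [set modulus (\tr (z *m (f *t g))) |
        f in [set f : 'M[C]_m | f \is hermsymmx /\ opnorm f <= 1] &
        g in [set g : 'M[C]_n | g \is hermsymmx /\ opnorm g <= 1]].

End MatrixNorms.

(* Main.v *)
(* Let n = min(nA, nB), and split a contraction x with tr(z x) = ||z||_1 into
   n^2 blocks x_ij along the smaller factor.  If U is a random unitary n x n
   matrix with the moments of order (2,2) of the Haar measure and
   S = sum_ij conj(U_ij) x_ij, then x_ij = n E[U_ij S], so that
   tr(z x) = n E[z(U, S)].  Here S is not bounded, but the Weingarten formula
   gives E|S|^4 <= 2 and E|S^*|^4 <= 2, so replacing S by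
   S (1 + S^* S / 2)^-1, of norm at most 1/sqrt 2, leaves an error whose
   blocks satisfy the same row and column square-function bounds as x with
   constant 1/2.  Absorbing this error gives
   ||z||_1 <= sqrt 2 * n * ||z||_eps.  For selfadjoint z, taking real parts
   shows that ||z||_eps is at most twice its selfadjoint version. *)
Require Import Defs.
From mathcomp Require Import all_boot all_order all_fingroup all_algebra.
From mathcomp Require Import cyclic separable cyclotomic ring lra.
From mathcomp Require Import boolp classical_sets reals.
From mathcomp.real_closed Require Import complex mxtens.

Set Implicit Arguments.
Unset Strict Implicit.
Unset Printing Implicit Defensive.

Import Order.TTheory GRing.Theory Num.Theory.

Local Open Scope classical_set_scope.
Local Open Scope ring_scope.
Local Open Scope sesquilinear_scope.

(** * A finite unitary 2-design *)

(** Only moments of order (2,2) enter, so a finite weighted family of unitaries stands in for the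
    Haar measure and every expectation is a finite sum. The error left by truncation need not
    consist of the blocks of a contraction, so the supremum N to be bounded is taken over all
    families in [in_ball], a set that the rescaled error cannot leave. Absorption requires N to be
    finite; any bound depending on n will do, since it does not enter the final constant. The
    coefficient 1/2 in the truncation is the best one: with S (1 + t S^* S)^-1 the truncated part
    has norm at most 1/(2 sqrt t), the blocks of the error lie in sqrt(t/2) times the ball, and N <=
    n e / (2 sqrt t) + sqrt(t/2) N, where e = ||z||_eps, gives the smallest bound at t = 1/2. The
    Weingarten formula has n - 1 in a denominator, so n = 1 is handled apart, by the crude bound. *)

Section UniformMoments.
Context {C : numClosedFieldType}.

Lemma sum_prod (A B : finType) (V : nmodType) (F : A * B -> V) :
  \sum_w F w = \sum_a \sum_b F (a, b).
Proof. by rewrite pair_bigA; apply: eq_bigr => -[]. Qed.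

Definition phase (k : 'I_4) : C := 'i ^+ k.

Lemma phaseDr (k : 'I_4) : phase (k + 1) = 'i * phase k.
Proof.
have i2 : 'i * 'i = -1 :> C by rewrite -expr2 sqrCi.
by case: k => -[|[|[|[|//]]]] lt4; rewrite /phase /= ?expr0 ?expr1 ?mulr1 //
  ?exprS ?expr0 ?mulr1 ?mulrA ?i2 ?mulNr ?mul1r ?i2 ?opprK.
Qed.

Lemma phase_conj (k : 'I_4) : phase k * (phase k)^* = 1.
Proof. by rewrite -normCK normrX normCi !expr1n. Qed.

(** Adding 1 to one coordinate of [e] permutes the index set and multiplies every summand by the
    same factor, so the sum vanishes as soon as some coordinate gives a factor other than 1. Signs
    instead of fourth roots of unity would leave the unwanted case a = c, b = d. *)
Lemma phase_moment n (a b c d : 'I_n) :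
  \sum_(e : {ffun 'I_n -> 'I_4})
     phase (e a) * (phase (e b))^* * phase (e c) * (phase (e d))^*
  = #|{ffun 'I_n -> 'I_4}|%:R
    * ((a == b) && (c == d) || (a == d) && (b == c))%:R.
Proof.
pose f (e : {ffun 'I_n -> 'I_4}) : C :=
  phase (e a) * (phase (e b))^* * phase (e c) * (phase (e d))^*.
pose shift (m : 'I_n) (e : {ffun 'I_n -> 'I_4}) : {ffun 'I_n -> 'I_4} :=
  [ffun x => if x == m then e x + 1 else e x].
pose t (m x : 'I_n) : C := if x == m then 'i else 1.
have shiftE m e x : phase (shift m e x) = t m x * phase (e x).
  by rewrite /shift /t ffunE; case: eqP; rewrite ?phaseDr ?mul1r.
have shift_bij m : bijective (shift m).
  apply: injF_bij => e e' /ffunP ee'; apply/ffunP => x.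
  by have := ee' x; rewrite !ffunE; case: ifP => // _ /addIr.
have zero m : t m a * (t m b)^* * t m c * (t m d)^* != 1 -> \sum_e f e = 0.
  set z := (X in X != 1) => z1.
  have : \sum_e f e = z * \sum_e f e.
    rewrite {1}(reindex (shift m)) /=; last exact: onW_bij.
    rewrite mulr_sumr; apply: eq_bigr => e _.
    by rewrite /f !shiftE !rmorphM /= /z; ring.
  move/eqP; rewrite -subr_eq0 -{1}[\sum_e f e]mul1r -mulrBl mulf_eq0.
  by rewrite subr_eq0 eq_sym (negPf z1) /= => /eqP.
have N11 : -1 != 1 :> C.
  by rewrite -subr_eq0 -opprD oppr_eq0 -(natrD C 1 1) pnatr_eq0.
have i1 : 'i != 1 :> C.
  by apply: contra N11 => /eqP i1; rewrite -(sqrCi C) i1 expr1n.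
rewrite -/(\sum_e f e).
have [/andP[/eqP ab /eqP cd]|nab] /= := boolP ((a == b) && (c == d)).
  under eq_bigr => e _ do rewrite /f ab cd -mulrA !phase_conj mulr1.
  by rewrite sumr_const mulr1.
have [/andP[/eqP ad /eqP bc]|nad] := boolP ((a == d) && (b == c)).
  under eq_bigr => e _ do
    rewrite /f ad bc -mulrA [_ * (phase (e d))^*]mulrC mulrACA phase_conj
            mul1r mulrC phase_conj.
  by rewrite sumr_const mulr1.
rewrite mulr0; have [ab|/negPf ab] := eqVneq a b.
  move: nab; rewrite ab eqxx /= => /negPf cd.
  apply: (zero c); rewrite /t ab eqxx [d == c]eq_sym cd /= rmorph1 mulr1.
  by case: (b == c); rewrite ?rmorph1 ?mulr1 ?mul1r // -normCK normCi expr1n mul1r.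
have [ad|/negPf ad] := eqVneq a d.
  move: nad; rewrite ad eqxx /= => /negPf bc.
  apply: (zero c); rewrite /t ad eqxx bc /= rmorph1 mulr1.
  case: (d == c); rewrite ?rmorph1 ?mulr1 ?mul1r //.
  by rewrite -mulrA -normCK normCi expr1n mulr1.
apply: (zero a); rewrite /t eqxx [b == a]eq_sym ab [d == a]eq_sym ad /=.
rewrite rmorph1 !mulr1; case: (c == a); rewrite ?mulr1 //.
by rewrite -expr2 sqrCi.
Qed.

Lemma sum_perm1 n (F : 'I_n -> C) (i : 'I_n) :
  n%:R * \sum_(s : 'S_n) F (s i) = #|'S_n|%:R * \sum_r F r.
Proof.
have h k : \sum_(s : 'S_n) F (s i) = \sum_(s : 'S_n) F (s k).
  rewrite (reindex_inj (mulgI (tperm i k))) /=.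
  by apply: eq_bigr => s _; rewrite permM tpermL.
transitivity (\sum_(k < n) \sum_(s : 'S_n) F (s k)).
  by rewrite -(eq_bigr _ (fun k _ => h k)) sumr_const card_ord mulr_natl.
rewrite exchange_big /= mulr_natl -sumr_const; apply: eq_bigr => s _.
by rewrite [RHS](reindex_inj (@perm_inj _ s)).
Qed.

Lemma sum_perm2 n (F : 'I_n -> 'I_n -> C) (i k : 'I_n) : i != k ->
  n%:R * (n%:R - 1) * \sum_(s : 'S_n) F (s i) (s k)
  = #|'S_n|%:R * \sum_r \sum_(s | s != r) F r s.
Proof.
move=> ik.
have h i' k' : k' != i' ->
    \sum_(s : 'S_n) F (s i') (s k') = \sum_(s : 'S_n) F (s i) (s k).
  move=> ik'; pose t := (tperm (tperm i' i k') k * tperm i' i)%g.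
  (* Double transitivity: the first transposition moves i' to i, the second moves the image of k' to
     k and fixes i. *)
  rewrite [LHS](reindex_inj (mulgI (tperm i' i * tperm (tperm i' i k') k)%g)) /=.
  apply: eq_bigr => s _; rewrite !permM tpermL tpermL tpermD //.
  - by rewrite -[X in _ != X](tpermL i' i) (inj_eq perm_inj).
  - by rewrite eq_sym.
transitivity (\sum_(i' < n) \sum_(k' < n | k' != i')
                \sum_(s : 'S_n) F (s i') (s k')).
  rewrite (eq_bigr (fun _ : 'I_n => (n%:R - 1) * \sum_(s : 'S_n) F (s i) (s k))); last first.
    move=> i' _; rewrite (eq_bigr _ (fun k' => @h i' k')) sumr_const.
    rewrite -[LHS]mulr_natl; congr (_ * _).
    rewrite (_ : #|_| = n.-1); last first.
      by rewrite -[in RHS](card_ord n) -(cardC1 i').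
    by rewrite -subn1 natrB // (leq_ltn_trans _ (ltn_ord i)).
  by rewrite sumr_const card_ord -[RHS]mulr_natl mulrA.
under eq_bigr do rewrite exchange_big /=.
rewrite exchange_big /= mulr_natl -sumr_const; apply: eq_bigr => s _.
rewrite [RHS](reindex_inj (@perm_inj _ s)); apply: eq_bigr => r _.
rewrite [RHS](reindex_inj (@perm_inj _ s)).
by apply: eq_bigl => j; rewrite (inj_eq perm_inj).
Qed.

Lemma prim_root_exists n : (n > 0)%N -> exists z : C, n.-primitive_root z.
Proof.
pose p : {poly C} := 'X^n - 1; have [r Dp] := closed_field_poly_normal p.
move=> n_gt0; rewrite (monicP _) ?monicXnsubC // scale1r in Dp.
have rn1 : all n.-unity_root r by apply/allP=> z; rewrite -root_prod_XsubC -Dp.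
have sz_r : (n < (size r).+1)%N by rewrite -(size_prod_XsubC r id) -Dp size_XnsubC.
have [|z] := hasP (has_prim_root n_gt0 rn1 _ sz_r); last by exists z.
by rewrite -separable_prod_XsubC -Dp separable_Xn_sub_1 // pnatr_eq0 -lt0n.
Qed.

Definition fourier (n : nat) (z : C) : 'M[C]_n :=
  \matrix_(i, j) (z ^+ (i * j) / sqrtC n%:R).

Section Fourier.
Variables (n : nat) (z : C).
Hypotheses (n_gt0 : (0 < n)%N) (prim_z : n.-primitive_root z).

Lemma prim_root_conj : z * z^* = 1.
Proof.
have : `|z| ^+ n = 1 by rewrite -normrX (prim_expr_order prim_z) normr1.
by move/eqP; rewrite pexpr_eq1 // => /eqP nz; rewrite -normCK nz expr1n.
Qed.

Lemma prim_exp_conj k : z ^+ k * (z ^+ k)^* = 1.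
Proof. by rewrite rmorphXn -exprMn prim_root_conj expr1n. Qed.

Lemma fourier_norm i j : fourier n z i j * (fourier n z i j)^* = n%:R^-1.
Proof.
rewrite !mxE rmorphM fmorphV mulrACA prim_exp_conj mul1r -invfM -normCK.
by rewrite ger0_norm ?sqrtCK // sqrtC_ge0.
Qed.

Lemma fourier_unitary : fourier n z \is unitarymx.
Proof.
apply/unitarymxP/matrixP => i k; rewrite !mxE.
transitivity (n%:R^-1 * \sum_(j < n) (z ^+ i * (z ^+ k)^* ) ^+ j).
  rewrite mulr_sumr; apply: eq_bigr => j _; rewrite !mxE.
  rewrite rmorphM fmorphV mulrACA -invfM -normCK.
  rewrite ger0_norm ?sqrtCK ?sqrtC_ge0 // mulrC; congr (_ * _).
  by rewrite exprMn -exprM -rmorphXn -exprM.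
have [<-|ik] := eqVneq i k.
  under eq_bigr do rewrite prim_exp_conj expr1n.
  by rewrite sumr_const card_ord mulVf // pnatr_eq0 -lt0n.
set w := z ^+ i * _.
have w1 : w != 1.
  apply: contra ik => /eqP wE; apply/eqP/val_inj/eqP => /=.
  rewrite -(modn_small (ltn_ord i)) -[X in _ == X](modn_small (ltn_ord k)).
  rewrite -(eq_prim_root_expr prim_z) -[z ^+ i]mulr1 -(prim_exp_conj k).
  by rewrite mulrCA -/w wE mulr1.
have wn : w ^+ n = 1.
  rewrite exprMn -rmorphXn -!exprM ![(_ * n)%N]mulnC !exprM.
  by rewrite !(prim_expr_order prim_z) !expr1n rmorph1 mulr1.
suff -> : \sum_(j < n) w ^+ j = 0 by rewrite mulr0.
apply/eqP; move/eqP: (subrX1 w n); rewrite wn subrr eq_sym mulf_eq0.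
by rewrite subr_eq0 (negPf w1).
Qed.

End Fourier.

End UniformMoments.

Section TwoDesign.
Context {C : numClosedFieldType}.

Definition pairing n (a b c d : 'I_n) : C := ((a == b) && (c == d))%:R.

(* The moments of order (2,2) of the Haar measure, split according to the
   symmetric and antisymmetric tensors. *)
Definition weingarten n (i i' k k' j j' l l' : 'I_n) : C :=
  (pairing i i' k k' + pairing i k' k i')
    * (pairing j j' l l' + pairing j l' l j') / (2 * n%:R * (n%:R + 1))
  + (pairing i i' k k' - pairing i k' k i')
    * (pairing j j' l l' - pairing j l' l j') / (2 * n%:R * (n%:R - 1)).

(** The weights [p] are needed because the design built below mixes two families with unequal
    probabilities. *)
Definition two_design n (T : finType) (p : T -> C) (U : T -> 'M[C]_n) :=
  [/\ forall w, 0 <= p w, \sum_w p w = 1, forall w, U w \is unitarymx &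
      forall i i' k k' j j' l l',
        \sum_w p w * (U w i j * (U w i' j')^* * U w k l * (U w k' l')^*)
        = weingarten i i' k k' j j' l l'].

Section PermutedRows.
Variables (n : nat) (V : 'M[C]_n).
Hypothesis V_unitary : V \is unitarymx.

(** The one quantity of [V] that survives averaging over row permutations: it is extreme for the
    identity and flat for the Fourier matrix. *)
Definition overlap j l : C :=
  \sum_r V r j * (V r j)^* * (V r l * (V r l)^*).

Lemma unitary_col_ortho j l : \sum_r V r j * (V r l)^* = (j == l)%:R.
Proof.
have := V_unitary; rewrite -trmx_unitary => /unitarymxP/matrixP/(_ j l).
by rewrite !mxE => <-; apply: eq_bigr => r _; rewrite !mxE.
Qed.

Lemma sum_offdiag (F : 'I_n -> 'I_n -> C) :
  \sum_r \sum_(s | s != r) F r s = \sum_r \sum_s F r s - \sum_r F r r.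
Proof.
rewrite -sumrB; apply: eq_bigr => r _.
by rewrite [in RHS](bigD1 r) //= addrAC subrr add0r.
Qed.

Lemma perm_rows_same i j l :
  n%:R * \sum_(s : 'S_n) V (s i) j * (V (s i) j)^* * (V (s i) l * (V (s i) l)^*)
  = #|'S_n|%:R * overlap j l.
Proof. exact: (sum_perm1 (fun r => V r j * (V r j)^* * (V r l * (V r l)^*))). Qed.

(** A sum over distinct rows is the full double sum, which orthonormality of the columns evaluates,
    minus the diagonal, which is [overlap]. The crossed sums are treated alike. *)
Lemma perm_rows_direct i k j l : i != k ->
  n%:R * (n%:R - 1) *
    \sum_(s : 'S_n) V (s i) j * (V (s i) j)^* * (V (s k) l * (V (s k) l)^*)
  = #|'S_n|%:R * (1 - overlap j l).
Proof.
move=> ik; rewrite (sum_perm2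
  (fun r s => V r j * (V r j)^* * (V s l * (V s l)^*)) ik) sum_offdiag.
congr (_ * (_ - _)); under eq_bigr do rewrite -mulr_sumr unitary_col_ortho eqxx.
by rewrite -mulr_suml unitary_col_ortho eqxx mulr1.
Qed.

Lemma perm_rows_crossed i k j l : i != k ->
  n%:R * (n%:R - 1) *
    \sum_(s : 'S_n) V (s i) j * (V (s i) l)^* * (V (s k) l * (V (s k) j)^*)
  = #|'S_n|%:R * ((j == l)%:R - overlap j l).
Proof.
move=> ik; rewrite (sum_perm2
  (fun r s => V r j * (V r l)^* * (V s l * (V s j)^*)) ik) sum_offdiag.
congr (_ * (_ - _)); last by apply: eq_bigr => r _; ring.
under eq_bigr do rewrite -mulr_sumr unitary_col_ortho [l == j]eq_sym.
by rewrite -mulr_suml unitary_col_ortho -natrM mulnb andbb.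
Qed.

End PermutedRows.

Lemma overlap1 n (j l : 'I_n) : overlap 1%:M j l = (j == l)%:R.
Proof.
rewrite /overlap (bigD1 j) //= big1 => [|r rj]; last first.
  by rewrite !mxE (negPf rj) !mul0r.
by rewrite !mxE eqxx; case: eqP; rewrite ?rmorph1 ?rmorph0 ?mulr1 ?mulr0 ?addr0.
Qed.

Lemma overlap_fourier n (z : C) (j l : 'I_n) : (0 < n)%N -> n.-primitive_root z ->
  overlap (fourier n z) j l = n%:R^-1.
Proof.
move=> n0 zP; rewrite /overlap; under eq_bigr do rewrite !fourier_norm //.
by rewrite sumr_const card_ord -[LHS]mulr_natl mulrA mulfV ?mul1r // pnatr_eq0 -lt0n.
Qed.

Definition rand_unitary n (V : 'M[C]_n) (e f : {ffun 'I_n -> 'I_4}) (s : 'S_n) :=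
  \matrix_(i, j) (phase (e i) * V (s i) j * phase (f j)) : 'M[C]_n.

Lemma rand_unitaryP n (V : 'M[C]_n) e f s :
  V \is unitarymx -> rand_unitary V e f s \is unitarymx.
Proof.
move=> /unitarymxP/matrixP VP; apply/unitarymxP/matrixP => i k.
have := VP (s i) (s k); rewrite !mxE (inj_eq perm_inj) => VE.
transitivity (phase (e i) * (phase (e k))^* * (i == k)%:R : C).
  rewrite -VE mulr_sumr; apply: eq_bigr => j _; rewrite !mxE !rmorphM /=.
  by rewrite -[RHS]mulr1 -(phase_conj (f j)); ring.
by case: eqP => [->|_]; rewrite ?mulr0 ?mulr1 ?phase_conj.
Qed.

(* The identity and the Fourier matrix are mixed so as to give the entries
   the fourth moment 2 / (n (n + 1)) of the Haar measure; phases, permutations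
   and unitarity then force all other moments. *)
Lemma two_design_exists n : (1 < n)%N ->
  exists (T : finType) (p : T -> C) (U : T -> 'M[C]_n), two_design p U.
Proof.
move=> n1; have n0 := ltnW n1; have [z zP] := @prim_root_exists C n n0.
pose E := {ffun 'I_n -> 'I_4}.
pose V (b : bool) := if b then 1%:M else fourier n z.
have V_unitary b : V b \is unitarymx.
  rewrite /V; case: b; last exact: (fourier_unitary n0 zP).
  by apply/unitarymxP; rewrite trmx1 map_mx1 mulmx1.
(* The weight q of the identity solves q / n + (1 - q) / n^2 = 2 / (n (n + 1)), the left side being
   the mean of |U_ij|^4. *)
pose q (b : bool) : C := if b then 1 / (n%:R + 1) else n%:R / (n%:R + 1).
have Np : n%:R + 1 != 0 :> C by rewrite natr1 pnatr_eq0.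
have N0 : n%:R != 0 :> C by rewrite pnatr_eq0 -lt0n.
have N1 : n%:R - 1 != 0 :> C by rewrite subr_eq0 (eqr_nat _ n 1) gtn_eqF.
have S0 : #|'S_n|%:R != 0 :> C by rewrite pnatr_eq0 card_Sn -lt0n fact_gt0.
have E0 : #|E|%:R != 0 :> C.
  by rewrite pnatr_eq0 -lt0n; apply/card_gt0P; exists [ffun=> 0].
pose T := (E * E * 'S_n * bool)%type.
pose p (w : T) := #|E|%:R^-1 * #|E|%:R^-1 * #|'S_n|%:R^-1 * q w.2.
pose U (w : T) := rand_unitary (V w.2) w.1.1.1 w.1.1.2 w.1.2.
(* By independence the left phases force the rows to be paired and the right phases the columns; an
   average over permutations and over the choice of [V] remains. *)
have factor a a' c c' b b' d d' :
    \sum_w p w * (U w a b * (U w a' b')^* * U w c d * (U w c' d')^*)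
  = ((a == a') && (c == c') || (a == c') && (a' == c))%:R
    * ((b == b') && (d == d') || (b == d') && (b' == d))%:R
    * \sum_t q t * (#|'S_n|%:R^-1 * \sum_(s : 'S_n)
        V t (s a) b * (V t (s a') b')^* * V t (s c) d * (V t (s c') d')^*).
  rewrite [LHS]sum_prod [LHS]sum_prod [LHS]sum_prod.
  pose P x y u v (e : E) : C :=
    phase (e x) * (phase (e y))^* * phase (e u) * (phase (e v))^*.
  pose G := \sum_t q t * (#|'S_n|%:R^-1 * \sum_(s : 'S_n)
        V t (s a) b * (V t (s a') b')^* * V t (s c) d * (V t (s c') d')^*).
  transitivity (\sum_(e : E) (#|E|%:R^-1 * P a a' c c' e)
     * \sum_(f : E) (#|E|%:R^-1 * P b b' d d' f) * G); last first.
    rewrite -mulr_suml -mulr_sumr phase_moment mulKf //.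
    by rewrite -mulr_suml -mulr_sumr phase_moment mulKf // mulrA.
  apply: eq_bigr => e _; rewrite mulr_sumr; apply: eq_bigr => f _.
  rewrite /G !mulr_sumr exchange_big; apply: eq_bigr => t _.
  rewrite !mulr_sumr; apply: eq_bigr => s _.
  by rewrite /p /U /= !mxE !rmorphM /P /=; ring.
exists T, p, U; split.
- by move=> w; rewrite !mulr_ge0 ?invr_ge0 ?ler0n // /q; case: ifP => _;
    rewrite divr_ge0 ?addr_ge0 ?ler01 ?ler0n.
- rewrite [LHS]sum_prod [LHS]sum_prod [LHS]sum_prod /p /=.
  have q1 : \sum_t q t = 1 by rewrite big_bool /q /=; field.
  under eq_bigr do under eq_bigr do under eq_bigr do rewrite -mulr_sumr q1 mulr1.
  rewrite !sumr_const -[LHS]mulr_natr -[X in X * _ = _]mulr_natr.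
  rewrite -[X in X * _ * _ = _]mulr_natr.
  by field; rewrite E0 S0.
- by move=> w; apply: rand_unitaryP.
have direct i k j l :
    \sum_t q t * (#|'S_n|%:R^-1 * \sum_(s : 'S_n)
        V t (s i) j * (V t (s i) j)^* * (V t (s k) l * (V t (s k) l)^*))
  = (1 + (i == k)%:R) * (1 + (j == l)%:R) / (2 * n%:R * (n%:R + 1))
    + (1 - (i == k)%:R) * (1 - (j == l)%:R) / (2 * n%:R * (n%:R - 1)).
  rewrite big_bool /q /V /=; have [<-|ik] := eqVneq i k.
    set A := \sum_s _; set B := \sum_s _.
    have -> : A = n%:R^-1 * (#|'S_n|%:R * (j == l)%:R).
      by rewrite -overlap1 -(perm_rows_same _ i) mulKf.
    have -> : B = n%:R^-1 * (#|'S_n|%:R * n%:R^-1).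
      by rewrite -{2}(overlap_fourier j l n0 zP) -(perm_rows_same _ i) mulKf.
    by rewrite /=; field; rewrite N0 Np S0 N1.
  set A := \sum_s _; set B := \sum_s _.
  have -> : A = (n%:R * (n%:R - 1))^-1 * (#|'S_n|%:R * (1 - (j == l)%:R)).
    by rewrite -overlap1 -(perm_rows_direct (V_unitary true) _ _ ik)
      mulKf // mulf_neq0.
  have -> : B = (n%:R * (n%:R - 1))^-1 * (#|'S_n|%:R * (1 - n%:R^-1)).
    by rewrite -(overlap_fourier j l n0 zP)
      -(perm_rows_direct (V_unitary false) _ _ ik) mulKf // mulf_neq0.
  by case: (j == l) => /=; field; rewrite N0 Np S0 N1.
have crossed i k j l :
    \sum_t q t * (#|'S_n|%:R^-1 * \sum_(s : 'S_n)
        V t (s i) j * (V t (s i) l)^* * (V t (s k) l * (V t (s k) j)^*))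
  = (1 + (i == k)%:R) * ((j == l)%:R + 1) / (2 * n%:R * (n%:R + 1))
    + (1 - (i == k)%:R) * ((j == l)%:R - 1) / (2 * n%:R * (n%:R - 1)).
  have [<-|ik] := eqVneq i k.
    transitivity ((1 + (i == i)%:R) * (1 + (j == l)%:R) / (2 * n%:R * (n%:R + 1))
      + (1 - (i == i)%:R) * (1 - (j == l)%:R) / (2 * n%:R * (n%:R - 1)) : C);
      last by rewrite eqxx /=; ring.
    rewrite -direct.
    apply: eq_bigr => t _; congr (_ * (_ * _)).
    by apply: eq_bigr => s _; ring.
  rewrite big_bool /q /V /=.
  set A := \sum_s _; set B := \sum_s _.
  have -> : A = (n%:R * (n%:R - 1))^-1 * (#|'S_n|%:R * ((j == l)%:R - (j == l)%:R)).
    by rewrite -{2}overlap1 -(perm_rows_crossed (V_unitary true) _ _ ik)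
      mulKf // mulf_neq0.
  have -> : B = (n%:R * (n%:R - 1))^-1 * (#|'S_n|%:R * ((j == l)%:R - n%:R^-1)).
    by rewrite -(overlap_fourier j l n0 zP)
      -(perm_rows_crossed (V_unitary false) _ _ ik) mulKf // mulf_neq0.
  by case: (j == l) => /=; field; rewrite N0 Np S0 N1.
move=> i i' k k' j j' l l'; rewrite factor /weingarten /pairing.
have [rP|rN] := boolP (_ || _); last first.
  rewrite !mul0r; move: rN; rewrite negb_or [k == i']eq_sym.
  by move=> /andP[/negPf-> /negPf->]; rewrite subrr addr0 !mul0r addr0.
have [cP|cN] := boolP (_ || _); last first.
  rewrite mulr0 mul0r; move: cN; rewrite negb_or [l == j']eq_sym.
  by move=> /andP[/negPf-> /negPf->]; rewrite subrr addr0 !mulr0 !mul0r addr0.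
rewrite !mul1r.
have reassoc (x y u v : bool -> 'S_n -> C) :
    \sum_t q t * (#|'S_n|%:R^-1 * \sum_s x t s * y t s * u t s * v t s)
  = \sum_t q t * (#|'S_n|%:R^-1 * \sum_s x t s * y t s * (u t s * v t s)).
  by apply: eq_bigr => t _; congr (_ * (_ * _)); apply: eq_bigr => s _; ring.
rewrite reassoc.
(* Rows and columns are each paired straight or crossed. Commuting factors turns crossed rows into
   straight ones with the opposite pairing of columns. *)
case/orP: rP => /andP[/eqP<- /eqP<-]; case/orP: cP => /andP[/eqP<- /eqP<-];
  rewrite ?eqxx ?andTb ?andbT ?[k == i]eq_sym ?[l == j]eq_sym ?andbb.
- exact: direct.
- by rewrite crossed [j' == j]eq_sym andbb.
- rewrite [i' == i]eq_sym andbb; transitivity (\sum_t q t * (#|'S_n|%:R^-1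
     * \sum_(s : 'S_n)
        V t (s i) j * (V t (s i) l)^* * (V t (s i') l * (V t (s i') j)^*))).
    by apply: eq_bigr => t _; congr (_ * (_ * _)); apply: eq_bigr => s _; ring.
  by rewrite crossed /=; ring.
- rewrite [i' == i]eq_sym [j' == j]eq_sym !andbb.
  transitivity (\sum_t q t * (#|'S_n|%:R^-1 * \sum_(s : 'S_n)
     V t (s i) j * (V t (s i) j)^* * (V t (s i') j' * (V t (s i') j')^*))).
    by apply: eq_bigr => t _; congr (_ * (_ * _)); apply: eq_bigr => s _; ring.
  by rewrite direct /=; ring.
Qed.

End TwoDesign.

(** * Contractions and truncation *)

Section InnerProduct.
Context {C : numClosedFieldType}.

Definition dot m (u v : 'cV[C]_m) : C := (u^t* *m v) 0 0.

Section DotTheory.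
Variable m : nat.
Implicit Types (u v w : 'cV[C]_m) (a : C).

Lemma dotE u v : dot u v = \sum_i (u i 0)^* * v i 0.
Proof. by rewrite /dot mxE; apply: eq_bigr => i _; rewrite !mxE. Qed.

Lemma dotC u v : (dot u v)^* = dot v u.
Proof.
by rewrite !dotE rmorph_sum; apply: eq_bigr => i _; rewrite rmorphM /= conjCK mulrC.
Qed.

Lemma dotDr u v w : dot u (v + w) = dot u v + dot u w.
Proof. by rewrite /dot mulmxDr mxE. Qed.

Lemma dotNr u v : dot u (- v) = - dot u v.
Proof. by rewrite /dot mulmxN mxE. Qed.

Lemma dotZr a u v : dot u (a *: v) = a * dot u v.
Proof. by rewrite /dot -scalemxAr mxE. Qed.

Lemma dotDl u v w : dot (u + v) w = dot u w + dot v w.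
Proof. by rewrite -dotC dotDr rmorphD /= !dotC. Qed.

Lemma dotNl u v : dot (- u) v = - dot u v.
Proof. by rewrite -dotC dotNr rmorphN /= dotC. Qed.

Lemma dotZl a u v : dot (a *: u) v = a^* * dot u v.
Proof. by rewrite -dotC dotZr rmorphM /= dotC. Qed.

Lemma dot_sumr (I : finType) u (f : I -> 'cV[C]_m) :
  dot u (\sum_i f i) = \sum_i dot u (f i).
Proof. by rewrite /dot mulmx_sumr summxE. Qed.

Lemma dot_suml (I : finType) u (f : I -> 'cV[C]_m) :
  dot (\sum_i f i) u = \sum_i dot (f i) u.
Proof.
by rewrite -dotC dot_sumr rmorph_sum; apply: eq_bigr => i _; rewrite /= dotC.
Qed.

Definition nsq v := dot v v.

Lemma nsqE v : nsq v = \sum_i `|v i 0| ^+ 2.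
Proof. by rewrite /nsq dotE; apply: eq_bigr => i _; rewrite normCK mulrC. Qed.

Lemma nsq_ge0 v : 0 <= nsq v.
Proof. by rewrite nsqE sumr_ge0 // => i _; rewrite exprn_ge0. Qed.

Lemma nsqZ a v : nsq (a *: v) = `|a| ^+ 2 * nsq v.
Proof. by rewrite /nsq dotZl dotZr normCK mulrA [a^* * _]mulrC. Qed.

Lemma nsqD u v : nsq (u + v) = nsq u + nsq v + (dot u v + dot v u).
Proof. by rewrite /nsq dotDl !dotDr; ring. Qed.

Lemma nsqB u v : nsq (u - v) = nsq u + nsq v - (dot u v + dot v u).
Proof. by rewrite nsqD dotNr dotNl /nsq dotNl dotNr opprK opprD. Qed.

Lemma nsq_eq0 v : nsq v = 0 -> v = 0.
Proof.
rewrite nsqE => /eqP; rewrite psumr_eq0 => [|i _]; last exact: exprn_ge0.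
move=> /allP v0; apply/matrixP => i j; rewrite (ord1 j) mxE.
have := v0 i (mem_index_enum i).
by rewrite sqrf_eq0 normr_eq0 => /eqP.
Qed.

(** With W the sum of the w_j, the sum of the |k w_j - W|^2 equals k times the difference of the two
    sides. *)
Lemma nsq_sum_le k (w : 'I_k -> 'cV[C]_m) :
  nsq (\sum_j w j) <= k%:R * \sum_j nsq (w j).
Proof.
set W := \sum_j w j; case: k w @W => [|k] w W.
  by rewrite /W big_ord0 mul0r /nsq -[X in dot X _](scale0r 0) dotZl rmorph0 mul0r.
have k0 : 0 < k.+1%:R :> C by rewrite ltr0n.
have : 0 <= \sum_j nsq (k.+1%:R *: w j - W).
  by apply: sumr_ge0 => j _; exact: nsq_ge0.
under eq_bigr do rewrite nsqB nsqZ dotZl dotZr.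
rewrite sumrB !big_split /= sumr_const card_ord -[nsq W *+ _]mulr_natl.
rewrite -!mulr_sumr -(dot_sumr W w) -(dot_suml W w) -/W -/(nsq W).
rewrite normr_nat conjC_nat; set s := \sum_j _ => h.
by rewrite -subr_ge0 -(pmulr_rge0 _ k0); congr (0 <= _): h; ring.
Qed.

End DotTheory.

Lemma adjmxM m n k (A : 'M[C]_(m, n)) (B : 'M[C]_(n, k)) :
  (A *m B)^t* = B^t* *m A^t*.
Proof. by rewrite trmx_mul map_mxM. Qed.

Lemma dot_adjr m k (A : 'M[C]_(m, k)) u v : dot u (A *m v) = dot (A^t* *m u) v.
Proof. by rewrite /dot adjmxM trmxCK mulmxA. Qed.

Lemma dot_adjl m k (A : 'M[C]_(m, k)) u v : dot (A *m u) v = dot u (A^t* *m v).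
Proof. by rewrite dot_adjr trmxCK. Qed.

Definition contraction m k (A : 'M[C]_(m, k)) := forall v, nsq (A *m v) <= nsq v.

(** Expand |v - A A^* v|^2 >= 0 and bound |A A^* v| by |A^* v|. *)
Lemma contraction_adj m k (A : 'M[C]_(m, k)) : contraction A -> contraction (A^t*).
Proof.
move=> cA v; have := nsq_ge0 (v - A *m (A^t* *m v)).
rewrite nsqB [dot v _]dot_adjr [dot (A *m _) v]dot_adjl -/(nsq _) => h.
apply: le_trans (_ : nsq v + nsq (A *m (A^t* *m v)) - nsq (A^t* *m v) <= _).
  by rewrite -subr_ge0; congr (0 <= _): h; ring.
by rewrite lerBlDr lerD2l cA.
Qed.

Lemma unitary_contraction m (A : 'M[C]_m) : A \is unitarymx -> contraction A.
Proof.
rewrite -trmxC_unitary => /unitarymxP; rewrite trmxCK => AA v.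
by rewrite /nsq dot_adjl mulmxA AA mul1mx.
Qed.

Lemma contraction0 m k : contraction (0 : 'M[C]_(m, k)).
Proof.
by move=> v; rewrite mul0mx nsqE big1 ?nsq_ge0 // => i _; rewrite mxE normr0 expr0n.
Qed.

Lemma delta_contraction m k i j : contraction (delta_mx i j : 'M[C]_(m, k)).
Proof.
move=> v; have -> : delta_mx i j *m v = v j 0 *: delta_mx i 0.
  apply/matrixP => r s; rewrite (ord1 s) !mxE (bigD1 j) //= big1 => [|t tj].
    by rewrite !mxE eqxx andbT addr0 mulrC.
  by rewrite mxE (negPf tj) andbF mul0r.
rewrite nsqZ !nsqE [X in _ * X](bigD1 i) //= big1 => [|r ri]; last first.
  by rewrite mxE (negPf ri) normr0 expr0n.
rewrite mxE !eqxx normr1 expr1n addr0 mulr1 (bigD1 j) //= lerDl.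
by apply: sumr_ge0 => r _; rewrite exprn_ge0.
Qed.

End InnerProduct.

Section Truncation.
Context {C : numClosedFieldType} {m : nat}.
Implicit Types S : 'M[C]_m.

(* [trunc] plays the role of a spectral truncation, without functional
   calculus: s / (1 + s^2/2) <= 1/sqrt 2, and s - s / (1 + s^2/2) <= s^2 / sqrt 8. *)
Definition trunc_den S : 'M[C]_m := 1%:M + 2^-1 *: (S^t* *m S).
Definition trunc S : 'M[C]_m := S *m invmx (trunc_den S).

(** An operator form of sqrt 2 * s <= 1 + s^2 / 2: the difference of the two sides is exactly |w -
    S^* S w / 2|^2. *)
Lemma trunc_den_bound S (w : 'cV[C]_m) :
  2 * nsq (S *m w) <= nsq (trunc_den S *m w).
Proof.
rewrite /trunc_den mulmxDl mul1mx -scalemxAl -mulmxA.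
set s := S *m w; set q := S^t* *m s.
have wq : dot w q = nsq s by rewrite /q dot_adjr trmxCK.
have qw : dot q w = nsq s by rewrite /q dot_adjl trmxCK.
rewrite -subr_ge0; have := nsq_ge0 (w - 2^-1 *: q).
rewrite nsqB nsqD !nsqZ !dotZr !dotZl wq qw fmorphV normfV /= conjC_nat normr_nat => h.
by congr (0 <= _): h; field.
Qed.

Lemma trunc_den_adj S : (trunc_den S)^t* = trunc_den S.
Proof.
rewrite /trunc_den !linearD /= map_mxD trmx1 map_mx1 linearZ /= map_mxZ.
by rewrite adjmxM trmxCK fmorphV /= conjC_nat.
Qed.

Lemma trunc_den_unit S : trunc_den S \in unitmx.
Proof.
rewrite unitmxE unitfE; apply/det0P => -[v v0 vS].
have Jv : trunc_den S *m v^t* = 0.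
  by rewrite -trunc_den_adj -adjmxM vS trmx0 map_mx0.
have n0 (k : nat) : nsq (0 : 'cV[C]_k) = 0.
  by rewrite nsqE big1 // => i _; rewrite mxE normr0 expr0n.
have := trunc_den_bound S (v^t*); rewrite Jv n0 => le0.
have /nsq_eq0 Sv0 : nsq (S *m v^t*) = 0.
  by apply/eqP; rewrite eq_le nsq_ge0 andbT -(pmulr_rle0 _ (ltr0n C 2)).
move: Jv; rewrite /trunc_den mulmxDl mul1mx -scalemxAl -mulmxA Sv0 mulmx0.
by rewrite scaler0 addr0 => vt0; move: v0; rewrite -(trmxCK v) vt0 trmx0 map_mx0 eqxx.
Qed.

Lemma trunc_bound S (v : 'cV[C]_m) : 2 * nsq (trunc S *m v) <= nsq v.
Proof.
rewrite /trunc -mulmxA (le_trans (trunc_den_bound _ _)) //.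
by rewrite mulmxA mulmxV ?trunc_den_unit // mul1mx.
Qed.

(** With J = [trunc_den S] and v = J w, the error is S (S^* S w) / 2, while S^* S v = J (S^* S w)
    because J commutes with S^* S. The previous bound on J, applied at S^* S w, concludes. *)
Lemma trunc_rem_bound S (v : 'cV[C]_m) :
  8 * nsq ((S - trunc S) *m v) <= nsq (S^t* *m (S *m v)).
Proof.
pose w := invmx (trunc_den S) *m v.
have vE : v = trunc_den S *m w by rewrite /w mulmxA mulmxV ?trunc_den_unit // mul1mx.
have -> : (S - trunc S) *m v = 2^-1 *: (S *m (S^t* *m (S *m w))).
  rewrite mulmxBl /trunc -[_ *m v in X in _ - X]mulmxA -/w {1}vE.
  rewrite /trunc_den mulmxDl mul1mx mulmxDr addrAC subrr add0r.
  by rewrite -scalemxAl -scalemxAr !mulmxA.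
have -> : S^t* *m (S *m v) = trunc_den S *m (S^t* *m (S *m w)).
  rewrite vE /trunc_den !mulmxDl !mul1mx !mulmxDr -!scalemxAl -!scalemxAr.
  by rewrite !mulmxA.
rewrite nsqZ normfV normr_nat.
apply: le_trans (trunc_den_bound _ _); rewrite le_eqVlt; apply/orP; left.
by apply/eqP; field.
Qed.

(** Follows from J S^* = S^* J', with J and J' the denominators of S and S^*. It lets the bounds on
    adjoint blocks of the error be deduced from those on the blocks. *)
Lemma trunc_adj S : (trunc S)^t* = trunc (S^t*).
Proof.
apply: (can_inj (mulKmx (trunc_den_unit S))).
apply: (can_inj (mulmxK (trunc_den_unit (S^t*)))).
have -> : trunc_den S *m (trunc S)^t* = S^t*.
  by rewrite -{1}[trunc_den S]trunc_den_adj -adjmxM mulmxKV ?trunc_den_unit.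
rewrite /trunc mulmxA mulmxKV ?trunc_den_unit // /trunc_den trmxCK.
by rewrite mulmxDl mulmxDr mul1mx mulmx1 -scalemxAl -scalemxAr mulmxA.
Qed.

End Truncation.

(** * Moments of random block combinations *)

Section WeingartenSums.
Context {C : numClosedFieldType}.
Variable n : nat.
Hypothesis n1 : (1 < n)%N.
Local Notation I := ('I_n * 'I_n)%type.

Let N0 : n%:R != 0 :> C.
Proof. by rewrite pnatr_eq0 -lt0n ltnW. Qed.
Let Np : n%:R + 1 != 0 :> C.
Proof. by rewrite natr1 pnatr_eq0. Qed.
Let N1 : n%:R - 1 != 0 :> C.
Proof. by rewrite subr_eq0 (eqr_nat _ n 1) gtn_eqF. Qed.

(** The usual form, with the Weingarten function of the two permutations of S_2, 1 / (n^2 - 1) and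
    -1 / (n (n^2 - 1)). Each term fixes b and d in terms of a and c, so fourfold sums collapse to
    double ones. *)
Lemma weingartenE (a b c d : I) :
  weingarten a.1 b.1 c.1 d.1 a.2 b.2 c.2 d.2 =
  ((b == a)%:R * (d == c)%:R + (b == c)%:R * (d == a)%:R
   - ((b == (a.1, c.2))%:R * (d == (c.1, a.2))%:R
      + (b == (c.1, a.2))%:R * (d == (a.1, c.2))%:R) / n%:R)
  / (n%:R ^+ 2 - 1) :> C.
Proof.
have N2 : n%:R ^+ 2 - 1 != 0 :> C by rewrite subr_sqr_1 mulf_neq0.
case: a b c d => [i j] [i' j'] [k l] [k' l'] /=.
rewrite /weingarten /pairing !xpair_eqE /= -!mulnb !natrM.
rewrite ![_ == i]eq_sym ![_ == j]eq_sym [k' == k]eq_sym [l' == l]eq_sym.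
rewrite [k == i']eq_sym [l == j']eq_sym.
by field; rewrite N0 N1 Np N2.
Qed.

Lemma sum_delta2 (f g : I) (H : I -> I -> C) :
  \sum_b \sum_d (b == f)%:R * (d == g)%:R * H b d = H f g.
Proof.
rewrite (bigD1 f) //= [X in _ + X]big1 => [|b /negPf->]; last first.
  by apply: big1 => d _; rewrite !mul0r.
rewrite (bigD1 g) //= big1 => [|d /negPf->]; last by rewrite mulr0 mul0r.
by rewrite !eqxx !mul1r !addr0.
Qed.

Lemma weingarten_sum (H : I -> I -> I -> I -> C) :
  \sum_a \sum_c \sum_b \sum_d
     weingarten a.1 b.1 c.1 d.1 a.2 b.2 c.2 d.2 * H a b c d
  = (\sum_a \sum_c H a a c c + \sum_a \sum_c H a c c a
     - (\sum_a \sum_c H a (a.1, c.2) c (c.1, a.2)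
        + \sum_a \sum_c H a (c.1, a.2) c (a.1, c.2)) / n%:R)
    / (n%:R ^+ 2 - 1).
Proof.
set q := (_ - 1)^-1.
rewrite -!big_split /= mulr_suml -sumrB mulr_suml; apply: eq_bigr => a _.
rewrite -!big_split /= mulr_suml -sumrB mulr_suml; apply: eq_bigr => c _.
rewrite -(sum_delta2 a c (H a ^~ c)) -(sum_delta2 c a (H a ^~ c)).
rewrite -(sum_delta2 (a.1, c.2) (c.1, a.2) (H a ^~ c)).
rewrite -(sum_delta2 (c.1, a.2) (a.1, c.2) (H a ^~ c)).
rewrite -!big_split /= mulr_suml -sumrB mulr_suml; apply: eq_bigr => b _.
rewrite -!big_split /= mulr_suml -sumrB mulr_suml; apply: eq_bigr => d _.
by rewrite weingartenE -/q; ring.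
Qed.

End WeingartenSums.

Section RandomContraction.
Context {C : numClosedFieldType}.
Variables (n m : nat) (T : finType) (p : T -> C).
Hypothesis n1 : (1 < n)%N.
Local Notation I := ('I_n * 'I_n)%type.
Implicit Types (U : T -> 'M[C]_n) (x : I -> 'M[C]_m).

Let N0 : n%:R != 0 :> C.
Proof. by rewrite pnatr_eq0 -lt0n ltnW. Qed.
Let Npos : 0 < n%:R :> C.
Proof. by rewrite ltr0n ltnW. Qed.

(** The prescribed moments are real. This supplies the design for adjoints, since the adjoint of a
    mixture carries conjugated coefficients. *)
Lemma two_design_conj U :
  two_design p U -> two_design p (fun w => map_mx Num.conj (U w)).
Proof.
move=> [p0 p1 UU mom]; split => // [w|i i' k k' j j' l l'].
  by rewrite conjC_unitary.
have <- : (weingarten i i' k k' j j' l l')^* = weingarten i i' k k' j j' l l' :> C.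
  apply/CrealP; rewrite /weingarten /pairing.
  by do ?[exact: realn|exact: rpred1|apply: rpredB|apply: rpredD|apply: rpredM
         |rewrite rpredV].
rewrite -mom rmorph_sum; apply: eq_bigr => w _.
by rewrite !mxE !rmorphM /= !conjCK (CrealP (ger0_real (p0 w))).
Qed.

(** Insert the squared norm of row i, which is 1 by unitarity, and sum the moments of order
    (2,2). *)
Lemma second_moment U (a b : I) : two_design p U ->
  \sum_w p w * (U w a.1 a.2 * (U w b.1 b.2)^*) = (a == b)%:R / n%:R.
Proof.
move=> [p0 p1 UU mom]; case: a b => [i j] [i' j'] /=.
transitivity (\sum_l weingarten i i' i i j j' l l : C).
  rewrite -(eq_bigr _ (fun l _ => mom i i' i i j j' l l)) exchange_big /=.
  apply: eq_bigr => w _; rewrite -mulr_sumr; congr (_ * _).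
  under eq_bigr do rewrite -mulrA.
  rewrite -mulr_sumr.
  have /unitarymxP/matrixP/(_ i i) := UU w; rewrite !mxE eqxx.
  by under eq_bigr do rewrite !mxE; move=> ->; rewrite mulr1.
have Np : n%:R + 1 != 0 :> C by rewrite natr1 pnatr_eq0.
rewrite /weingarten /pairing !eqxx !andbT andTb subrr xpair_eqE.
under eq_bigr do rewrite eqxx andbT mul0r mul0r addr0 mulrAC.
rewrite -mulr_sumr big_split /= sumr_const card_ord -[X in X + _]mulr_natl.
rewrite -mulnb natrM (bigD1 j) //= big1 => [|l lj]; last first.
  by rewrite [j == l]eq_sym (negPf lj).
by rewrite eqxx addr0 /=; field; rewrite N0 Np.
Qed.

Definition mixture U x (w : T) : 'M[C]_m := \sum_a (U w a.1 a.2)^* *: x a.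

Lemma mixture_coef U x (b : I) : two_design p U ->
  x b = n%:R *: \sum_w (p w * U w b.1 b.2) *: mixture U x w.
Proof.
move=> dU; rewrite /mixture; under eq_bigr do rewrite scaler_sumr.
rewrite exchange_big /= (bigD1 b) //= [X in _ + X]big1 => [|a ab].
  under eq_bigr do rewrite scalerA -mulrA.
  rewrite -scaler_suml second_moment // eqxx addr0 scalerA mulrA mulr1.
  by rewrite mulfV // scale1r.
under eq_bigr do rewrite scalerA -mulrA.
by rewrite -scaler_suml second_moment // eq_sym (negPf ab) mul0r scale0r.
Qed.

(** The functions sqrt n * conj(U_a) are orthonormal for the weights [p]; this is Bessel's
    inequality for [F], with n * [G] as the orthogonal projection. *)
Lemma bessel U (F : T -> 'cV[C]_m) : two_design p U ->
  n%:R * \sum_(a : I) nsq (\sum_w (p w * U w a.1 a.2) *: F w)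
  <= \sum_w p w * nsq (F w).
Proof.
move=> dU; have [p0 _ _ _] := dU.
have pC w : (p w)^* = p w by apply/CrealP/ger0_real.
pose c (a : I) := \sum_w (p w * U w a.1 a.2) *: F w.
pose G w := \sum_(a : I) (U w a.1 a.2)^* *: c a.
have FG : \sum_w p w * dot (F w) (G w) = \sum_a nsq (c a).
  under eq_bigr do rewrite dot_sumr mulr_sumr.
  rewrite exchange_big; apply: eq_bigr => a _ /=.
  rewrite /nsq [X in _ = dot X _]/c dot_suml; apply: eq_bigr => w _.
  by rewrite dotZr dotZl rmorphM /= pC mulrA.
have GF : \sum_w p w * dot (G w) (F w) = \sum_a nsq (c a).
  under eq_bigr do rewrite dot_suml mulr_sumr.
  rewrite exchange_big; apply: eq_bigr => a _ /=.
  rewrite /nsq [X in _ = dot _ X]/c dot_sumr; apply: eq_bigr => w _.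
  by rewrite dotZr dotZl conjCK mulrA.
have GG : \sum_w p w * nsq (G w) = n%:R^-1 * \sum_a nsq (c a).
  transitivity (\sum_a \sum_b (\sum_w p w * (U w a.1 a.2 * (U w b.1 b.2)^*))
                  * dot (c a) (c b)).
    under [RHS]eq_bigr do under eq_bigr do rewrite mulr_suml.
    under [RHS]eq_bigr do rewrite exchange_big /=.
    rewrite [RHS]exchange_big; apply: eq_bigr => w _ /=.
    rewrite /nsq /G dot_suml mulr_sumr; apply: eq_bigr => a _.
    rewrite dot_sumr mulr_sumr; apply: eq_bigr => b _.
    by rewrite dotZl dotZr conjCK; ring.
  rewrite mulr_sumr; apply: eq_bigr => a _.
  rewrite (bigD1 a) //= [X in _ + X]big1 => [|b ba]; last first.
    by rewrite second_moment // eq_sym (negPf ba) mul0r mul0r.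
  by rewrite second_moment // eqxx addr0 mul1r.
have : 0 <= \sum_w p w * nsq (F w - n%:R *: G w).
  by apply: sumr_ge0 => w _; rewrite mulr_ge0 ?nsq_ge0.
under eq_bigr do rewrite nsqB nsqZ dotZl dotZr normr_nat conjC_nat.
rewrite (eq_bigr (fun w => p w * nsq (F w) + n%:R ^+ 2 * (p w * nsq (G w))
  - n%:R * (p w * dot (F w) (G w)) - n%:R * (p w * dot (G w) (F w)))); last first.
  by move=> w _; ring.
rewrite !sumrB big_split /= -!mulr_sumr FG GF GG => h.
by rewrite -subr_ge0; congr (0 <= _): h; rewrite -/(c _); field.
Qed.

(* The blocks of a contraction lie in this ball; unlike contractivity, membership
   only involves square functions, which second moments control. *)
Definition in_ball x :=
  (forall v, \sum_a nsq (x a *m v) <= n%:R * nsq v) /\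
  (forall v, \sum_a nsq ((x a)^t* *m v) <= n%:R * nsq v).

Lemma in_ball_adj x : in_ball x -> in_ball (fun a => (x a)^t*).
Proof.
move=> [h1 h2]; split => // v.
by under eq_bigr do rewrite trmxCK; exact: h1.
Qed.

Lemma mixture_adj U x w :
  (mixture U x w)^t* = mixture (fun w => map_mx Num.conj (U w)) (fun a => (x a)^t*) w.
Proof.
rewrite /mixture linear_sum raddf_sum; apply: eq_bigr => a _ /=.
by rewrite linearZ /= map_mxZ mxE.
Qed.

(* The two negative Weingarten terms each dominate |(sum_a x_a^* x_a) v|^2 / n,
   which is what brings the constant down to exactly 2. *)
Lemma fourth_moment U x v : two_design p U -> in_ball x ->
  \sum_w p w * nsq ((mixture U x w)^t* *m (mixture U x w *m v)) <= 2 * nsq v.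
Proof.
move=> [p0 _ _ mom] [ball1 ball2].
pose y (a b : I) := (x b)^t* *m (x a *m v).
pose H a b c d := dot (y a b) (y d c).
have -> : \sum_w p w * nsq ((mixture U x w)^t* *m (mixture U x w *m v))
  = \sum_a \sum_c \sum_b \sum_d
     weingarten a.1 b.1 c.1 d.1 a.2 b.2 c.2 d.2 * H a b c d.
  have E w : (mixture U x w)^t* *m (mixture U x w *m v)
      = \sum_a \sum_b ((U w a.1 a.2)^* * U w b.1 b.2) *: y a b.
    rewrite mixture_adj /mixture [X in _ *m X]mulmx_suml mulmx_sumr.
    apply: eq_bigr => a _.
    rewrite mulmx_suml; apply: eq_bigr => b _.
    by rewrite -!scalemxAl -scalemxAr scalerA mxE conjCK mulrC.
  transitivity (\sum_w \sum_a \sum_b \sum_d \sum_c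
      p w * dot (((U w a.1 a.2)^* * U w b.1 b.2) *: y a b)
                (((U w d.1 d.2)^* * U w c.1 c.2) *: y d c)).
    apply: eq_bigr => w _; rewrite E /nsq dot_suml mulr_sumr.
    apply: eq_bigr => a _; rewrite dot_suml mulr_sumr; apply: eq_bigr => b _.
    rewrite dot_sumr mulr_sumr; apply: eq_bigr => d _.
    by rewrite dot_sumr mulr_sumr.
  rewrite exchange_big /=; apply: eq_bigr => a _.
  transitivity (\sum_b \sum_d \sum_c
     weingarten a.1 b.1 c.1 d.1 a.2 b.2 c.2 d.2 * H a b c d); last first.
    rewrite [RHS]exchange_big; apply: eq_bigr => b _ /=.
    by rewrite exchange_big.
  rewrite exchange_big; apply: eq_bigr => b _.
  rewrite exchange_big; apply: eq_bigr => d _.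
  rewrite exchange_big; apply: eq_bigr => c _.
  rewrite -mom mulr_suml; apply: eq_bigr => w _.
  by rewrite dotZl dotZr rmorphM /= conjCK /H; ring.
(* Four terms remain: |bv|^2, the double square function over a and c, which the ball condition
   bounds applied twice, and the two negative terms with rows or columns exchanged. *)
rewrite weingarten_sum //.
pose bv := \sum_a y a a; set q := nsq v.
have A : \sum_a \sum_c H a a c c = nsq bv.
  rewrite /nsq /bv dot_suml; apply: eq_bigr => a _.
  by rewrite dot_sumr.
have B : \sum_a \sum_c H a c c a <= n%:R ^+ 2 * q.
  apply: (@le_trans _ _ (\sum_a n%:R * nsq (x a *m v))).
    by apply: ler_sum => a _; exact: ball2.
  by rewrite -mulr_sumr expr2 -mulrA ler_pM2l // ball1.
(* The sum is a sum of squares over j and l; keep the terms l = j and apply Cauchy-Schwarz to the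
   sum over j. The other negative term is treated in the same way with i and k. *)
have CC : n%:R^-1 * nsq bv <= \sum_a \sum_c H a (a.1, c.2) c (c.1, a.2).
  have -> : \sum_a \sum_c H a (a.1, c.2) c (c.1, a.2)
      = \sum_j \sum_l nsq (\sum_i y (i, j) (i, l)).
    rewrite [LHS]sum_prod exchange_big; apply: eq_bigr => j _.
    under eq_bigr do rewrite sum_prod exchange_big.
    rewrite exchange_big; apply: eq_bigr => l _ /=.
    rewrite /nsq dot_suml; apply: eq_bigr => i _.
    by rewrite dot_sumr.
  rewrite mulrC ler_pdivrMr // mulrC.
  have -> : bv = \sum_j \sum_i y (i, j) (i, j).
    by rewrite /bv sum_prod exchange_big.
  apply: (le_trans (nsq_sum_le _)); rewrite ler_pM2l //.
  apply: ler_sum => j _; rewrite [X in _ <= X](bigD1 j) //= lerDl.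
  by apply: sumr_ge0 => l _; exact: nsq_ge0.
have DD : n%:R^-1 * nsq bv <= \sum_a \sum_c H a (c.1, a.2) c (a.1, c.2).
  have -> : \sum_a \sum_c H a (c.1, a.2) c (a.1, c.2)
      = \sum_i \sum_k nsq (\sum_j y (i, j) (k, j)).
    rewrite [LHS]sum_prod; apply: eq_bigr => i _.
    under eq_bigr do rewrite sum_prod.
    rewrite exchange_big; apply: eq_bigr => k _ /=.
    rewrite /nsq dot_suml; apply: eq_bigr => j _.
    by rewrite dot_sumr.
  rewrite mulrC ler_pdivrMr // mulrC.
  have -> : bv = \sum_i \sum_j y (i, j) (i, j) by rewrite /bv sum_prod.
  apply: (le_trans (nsq_sum_le _)); rewrite ler_pM2l //.
  apply: ler_sum => i _; rewrite [X in _ <= X](bigD1 i) //= lerDl.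
  by apply: sumr_ge0 => k _; exact: nsq_ge0.
(* The operator K = sum_a x_a^* x_a is at most n, hence |K v| <= n |v|; expanding squares avoids a
   square root of K. *)
have bq : nsq bv <= n%:R ^+ 2 * q.
  have bvE (a : I) : dot v (y a a) = nsq (x a *m v).
    by rewrite /y dot_adjr trmxCK.
  have h : 0 <= \sum_a nsq (n%:R *: (x a *m v) - x a *m bv).
    by apply: sumr_ge0 => a _; exact: nsq_ge0.
  have S1 : \sum_a dot (x a *m v) (x a *m bv) = nsq bv.
    rewrite /nsq {2}/bv dot_suml; apply: eq_bigr => a _.
    by rewrite /y [RHS]dot_adjl trmxCK.
  have S2 : \sum_a dot (x a *m bv) (x a *m v) = nsq bv.
    rewrite /nsq {3}/bv dot_sumr; apply: eq_bigr => a _.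
    by rewrite /y [RHS]dot_adjr trmxCK.
  move: h; under eq_bigr do rewrite nsqB nsqZ dotZl dotZr normr_nat conjC_nat.
  rewrite sumrB !big_split /= -!mulr_sumr S1 S2 => h.
  have h1 : 0 <= n%:R * q - \sum_a nsq (x a *m v) by rewrite subr_ge0.
  have h2 : 0 <= n%:R * nsq bv - \sum_a nsq (x a *m bv) by rewrite subr_ge0.
  rewrite -subr_ge0 -(pmulr_rge0 _ Npos).
  have := addr_ge0 h (addr_ge0 (mulr_ge0 (exprn_ge0 2 (ltW Npos)) h1) h2).
  by congr (0 <= _); ring.
have Np : n%:R + 1 != 0 :> C by rewrite natr1 pnatr_eq0.
have N2 : 0 < n%:R ^+ 2 - 1 :> C.
  by rewrite subr_gt0 -natrX ltr1n -(expn0 n) ltn_exp2l.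
have N22 : 0 <= n%:R ^+ 2 - 2 :> C.
  by rewrite subr_ge0 -natrX ler_nat -mulnn (leq_trans n1) // leq_pmulr // ltnW.
rewrite ler_pdivrMr // A -subr_ge0.
set b := nsq bv in bq CC DD *; set B' := \sum_a _ in B *.
set C' := \sum_a _ in CC *; set D' := \sum_a _ in DD *.
rewrite -subr_ge0 in B; rewrite -subr_ge0 in bq.
rewrite -subr_ge0 in CC; rewrite -subr_ge0 in DD.
have inv0 : 0 <= n%:R^-1 :> C by rewrite invr_ge0 ltW.
(* A + B - (C + D) / n <= (1 - 2 / n^2) |bv|^2 + n^2 q <= (n^2 - 2) q + n^2 q = 2 (n^2 - 1) q. *)
have := addr_ge0 (addr_ge0 (mulr_ge0 (mulr_ge0 N22 (exprn_ge0 2 inv0)) bq) B)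
  (mulr_ge0 inv0 (addr_ge0 CC DD)).
by congr (0 <= _); field.
Qed.

End RandomContraction.

(** * Rounding to product tensors, up to half an element of the ball *)

Section Rounding.
Context {C : numClosedFieldType}.
Variables (n m : nat).
Local Notation I := ('I_n * 'I_n)%type.

Definition block_pair (y x : I -> 'M[C]_m) : C := \sum_a \tr (y a *m x a).

Definition block_form (y : I -> 'M[C]_m) (f : 'M[C]_n) (g : 'M[C]_m) : C :=
  block_pair y (fun a => f a.1 a.2 *: g).

Lemma block_pairZ y x c : block_pair y (fun a => c *: x a) = c * block_pair y x.
Proof.
by rewrite mulr_sumr; apply: eq_bigr => a _; rewrite -scalemxAr mxtraceZ.
Qed.

Lemma block_pairD y x x' :
  block_pair y (fun a => x a + x' a) = block_pair y x + block_pair y x'.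
Proof.
by rewrite -big_split; apply: eq_bigr => a _; rewrite /= mulmxDr mxtraceD.
Qed.

Lemma block_pair_sum (J : finType) y (x : J -> I -> 'M[C]_m) :
  block_pair y (fun a => \sum_j x j a) = \sum_j block_pair y (x j).
Proof.
rewrite exchange_big; apply: eq_bigr => a _ /=.
by rewrite mulmx_sumr raddf_sum.
Qed.

Lemma block_formZr y f g c : block_form y f (c *: g) = c * block_form y f g.
Proof.
rewrite /block_form -block_pairZ; apply: eq_bigr => a _.
by rewrite !scalerA mulrC.
Qed.

Lemma block_form_delta y (i j : 'I_n) g :
  block_form y (delta_mx i j) g = \tr (y (i, j) *m g).
Proof.
rewrite /block_form /block_pair (bigD1 (i, j)) //= big1 => [|a ai]; last first.
  rewrite mxE; case: a ai => k l; rewrite xpair_eqE /= => /negPf->.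
  by rewrite scale0r mulmx0 mxtrace0.
by rewrite mxE !eqxx scale1r addr0.
Qed.

Lemma contractionZ k l (A : 'M[C]_(k, l)) c b : 0 < b ->
  (forall v, nsq (A *m v) <= b * nsq v) -> `|c| ^+ 2 = b^-1 -> contraction (c *: A).
Proof.
by move=> b0 Ab cb v; rewrite -scalemxAl nsqZ cb mulrC ler_pdivrMr // mulrC.
Qed.

(** Tests one block at a time against a matrix unit, each block having norm at most sqrt n. It makes
    the supremum over the ball finite and settles n = 1. *)
Lemma block_pair_crude y x e : (0 < n)%N -> in_ball x ->
  (forall f g, contraction f -> contraction g -> `|block_form y f g| <= e) ->
  `|block_pair y x| <= n%:R ^+ 2 * (sqrtC n%:R * e).
Proof.
move=> n0 [ball1 _] bound.
apply: le_trans (ler_norm_sum _ _ _) _; set b := _ * e.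
have k0 : 0 < n%:R :> C by rewrite ltr0n.
have -> : n%:R ^+ 2 * b = \sum_(a : 'I_n * 'I_n) b.
  by rewrite sumr_const card_prod card_ord -natrX -mulnn mulr_natl.
apply: ler_sum => -[i j] _; rewrite -block_form_delta.
have s0 : 0 < sqrtC n%:R :> C by rewrite sqrtC_gt0.
have -> : x (i, j) = sqrtC n%:R *: ((sqrtC n%:R)^-1 *: x (i, j)).
  by rewrite scalerA mulfV ?scale1r // gt_eqF.
rewrite block_formZr normrM gtr0_norm // ler_pM2l // bound //.
  exact: delta_contraction.
apply: (contractionZ k0); last first.
  by rewrite normfV gtr0_norm // exprVn sqrtCK.
move=> v; apply: le_trans (ball1 v); rewrite (bigD1 (i, j)) //= lerDl.
by apply: sumr_ge0 => a _; exact: nsq_ge0.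
Qed.

Variables (T : finType) (p : T -> C).

(** Twice the error in n E[U_a S], so that it fills the ball again: Bessel, the truncation error and
    the fourth moment give 4 * n * (1/8) * 2 = n. *)
Definition remainder (U : T -> 'M[C]_n) (x : I -> 'M[C]_m) (a : I) : 'M[C]_m :=
  (2 * n%:R) *: \sum_w (p w * U w a.1 a.2) *:
     (mixture U x w - trunc (mixture U x w)).

Hypothesis n1 : (1 < n)%N.

Lemma remainder_bound U x v : two_design p U -> in_ball x ->
  \sum_a nsq (remainder U x a *m v) <= n%:R * nsq v.
Proof.
move=> dU bx; have [p0 _ _ _] := dU.
have N0 : 0 < n%:R :> C by rewrite ltr0n ltnW.
pose F w := (mixture U x w - trunc (mixture U x w)) *m v.
rewrite (eq_bigr (fun a : I => 4 * n%:R * (n%:R *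
    nsq (\sum_w (p w * U w a.1 a.2) *: F w)))); last first.
  move=> a _; rewrite /remainder -scalemxAl nsqZ mulmx_suml.
  under eq_bigr do rewrite -scalemxAl.
  by rewrite normrM !normr_nat; ring.
rewrite -!mulr_sumr.
have := bessel n1 F dU; rewrite -(ler_pM2l (_ : 0 < 4 * n%:R)) ?mulr_gt0 //.
move=> /le_trans; apply.
have := fourth_moment n1 v dU bx; set mom4 := \sum_w _ => mom4_le.
have {mom4_le} : n%:R / 2 * mom4 <= n%:R / 2 * (2 * nsq v).
  by rewrite ler_pM2l ?divr_gt0.
have -> : n%:R / 2 * (2 * nsq v) = n%:R * nsq v by field.
apply: le_trans.
have -> : 4 * n%:R * (\sum_w p w * nsq (F w))
    = n%:R / 2 * \sum_w p w * (8 * nsq (F w)).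
  rewrite [in RHS](eq_bigr (fun w => 8 * (p w * nsq (F w)))) => [|w _]; last by ring.
  by rewrite -mulr_sumr; field.
rewrite ler_pM2l ?divr_gt0 //; apply: ler_sum => w _.
by rewrite ler_wpM2l // trunc_rem_bound.
Qed.

Lemma remainder_adj (U : T -> 'M[C]_n) x a : two_design p U -> (remainder U x a)^t* =
  remainder (fun w => map_mx Num.conj (U w)) (fun a => (x a)^t*) a.
Proof.
move=> [p0 _ _ _]; rewrite /remainder linearZ /= map_mxZ rmorphM /= !conjC_nat.
congr (_ *: _); rewrite linear_sum raddf_sum; apply: eq_bigr => w _ /=.
rewrite linearZ /= map_mxZ rmorphM /= mxE (CrealP (ger0_real (p0 w))).
by rewrite linearB /= map_mxB trunc_adj mixture_adj.
Qed.

Lemma remainder_in_ball U x : two_design p U -> in_ball x ->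
  in_ball (remainder U x).
Proof.
move=> dU bx; split => v; first exact: remainder_bound.
under eq_bigr do rewrite remainder_adj //.
by apply: remainder_bound; [exact: two_design_conj | exact: in_ball_adj].
Qed.

(** Split x as n E[U trunc S] plus half the remainder. The factor sqrt 2 * trunc S is a contraction,
    whence e / sqrt 2 in the first term. *)
Lemma block_pair_step (U : T -> 'M[C]_n) y x e N : two_design p U ->
  (forall f g, contraction f -> contraction g -> `|block_form y f g| <= e) ->
  (forall x, in_ball x -> `|block_pair y x| <= N) -> in_ball x ->
  `|block_pair y x| <= n%:R * e / sqrtC 2 + N / 2.
Proof.
move=> dU bound ballN bx; have [p0 p1 UU _] := dU.
have s0 : 0 < sqrtC 2 :> C by rewrite sqrtC_gt0.
have -> : block_pair y x =
    \sum_w p w * (n%:R * block_form y (U w) (trunc (mixture U x w)))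
    + 2^-1 * block_pair y (remainder U x).
  rewrite -block_pairZ.
  under [X in X + _]eq_bigr do rewrite mulrA /block_form -block_pairZ.
  rewrite -block_pair_sum -block_pairD; apply: eq_bigr => a _.
  congr (\tr (_ *m _)); rewrite {1}(mixture_coef n1 x a dU) /remainder scalerA.
  rewrite mulKf ?pnatr_eq0 // [X in _ = X + _](_ : _ = n%:R *: \sum_w
    (p w * U w a.1 a.2) *: trunc (mixture U x w)).
    rewrite -scalerDr -big_split; congr (_ *: _); apply: eq_bigr => w _ /=.
    by rewrite -scalerDr addrC subrK.
  rewrite scaler_sumr; apply: eq_bigr => w _.
  by rewrite !scalerA; congr (_ *: _); ring.
apply: le_trans (ler_normD _ _) _; apply: lerD; last first.
  rewrite normrM normfV normr_nat mulrC ler_wpM2r ?invr_ge0 //.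
  by apply: ballN; exact: remainder_in_ball.
apply: le_trans (ler_norm_sum _ _ _) _.
rewrite -[X in _ <= X]mul1r -[X in _ <= X * _]p1 mulr_suml; apply: ler_sum => w _.
rewrite normrM (ger0_norm (p0 w)) ler_wpM2l // normrM normr_nat -mulrA.
rewrite ler_wpM2l // ler_pdivlMr // mulrC -{1}(gtr0_norm s0) -normrM -block_formZr.
apply: bound; first exact: unitary_contraction.
apply: (@contractionZ _ _ _ _ 2^-1) => [|v|].
- by rewrite invr_gt0.
- by rewrite mulrC ler_pdivlMr // mulrC trunc_bound.
- by rewrite invrK gtr0_norm // sqrtCK.
Qed.

End Rounding.

(** * Blocks of matrices and the trace norm *)

Section Modulus.
Context {R : realType}.
Local Notation C := R[i].

Lemma modulusE (a : C) : (modulus a)%:C%C = `|a|.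
Proof. by rewrite /modulus RRe_real // normr_real. Qed.

Lemma modulus_le (a : C) (k : R) : (modulus a <= k) = (`|a| <= k%:C%C).
Proof. by rewrite -modulusE lecR. Qed.

Lemma modulus_ge0 (a : C) : 0 <= modulus a.
Proof. by rewrite -ler0c modulusE normr_ge0. Qed.

Lemma Re_le_modulus (a : C) : complex.Re a <= modulus a.
Proof.
rewrite -lecR modulusE; apply: le_trans (normc_ge_Re a).
by rewrite lecR ler_norm.
Qed.

Lemma sqrtC2 : sqrtC 2 = (Num.sqrt 2)%:C%C :> C.
Proof.
have -> : 2 = (Num.sqrt 2)%:C%C ^+ 2 :> C.
  by rewrite -rmorphXn /= sqr_sqrtr // rmorph_nat.
by rewrite sqrCK // ler0c sqrtr_ge0.
Qed.

End Modulus.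

Section BlockBound.
Context {R : realType}.
Local Notation C := R[i].
Variables n m : nat.
Local Notation I := ('I_n * 'I_n)%type.

Lemma block_pair_le (y x : I -> 'M[C]_m) (e : R) : (0 < n)%N -> in_ball x ->
  (forall f g, contraction f -> contraction g -> modulus (block_form y f g) <= e) ->
  modulus (block_pair y x) <= Num.sqrt 2 * n%:R * e.
Proof.
move=> n0 bx bound.
have boundC f g : contraction f -> contraction g -> `|block_form y f g| <= e%:C%C.
  by move=> cf cg; rewrite -modulus_le; exact: bound.
have e0 : 0 <= e.
  by apply: le_trans (bound 0 0 _ _);
    [exact: modulus_ge0 | exact: contraction0 | exact: contraction0].
have crude x' : in_ball x' -> `|block_pair y x'| <= n%:R ^+ 2 * (sqrtC n%:R * e%:C%C).
  by move=> bx'; exact: block_pair_crude.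
have [n1|n1] := ltnP 1 n; last first.
  have nE : n = 1%N by apply/eqP; rewrite eqn_leq n1.
  have [nC nR] : n%:R = 1 :> C /\ n%:R = 1 :> R by rewrite nE.
  have := crude x bx; rewrite nC nR expr1n mul1r sqrtC1 mul1r -modulus_le mulr1.
  move/le_trans; apply; rewrite ler_peMl // -[leLHS]sqrtr1 ler_wsqrtr //.
  by rewrite ler1n.
have [T [p [U dU]]] := @two_design_exists C n n1.
pose E := [set modulus (block_pair y x') | x' in [set x' | in_ball x']].
have ubE : has_ubound E.
  exists (complex.Re (n%:R ^+ 2 * (sqrtC n%:R * e%:C%C))) => _ [x' bx' <-].
  rewrite modulus_le RRe_real; first exact: crude.
  by rewrite ger0_real // !mulr_ge0 ?exprn_ge0 ?sqrtC_ge0 ?ler0c.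
have supE x' : in_ball x' -> `|block_pair y x'| <= (sup E)%:C%C.
  by move=> bx'; rewrite -modulus_le; apply: ub_le_sup => //; exists x'.
have step x' : in_ball x' ->
    modulus (block_pair y x') <= n%:R * e / Num.sqrt 2 + sup E / 2.
  move=> bx'; rewrite modulus_le.
  have := block_pair_step n1 dU boundC supE bx'.
  by rewrite sqrtC2 !(rmorphD, rmorphM, fmorphV, rmorph_nat).
(* Absorption: N <= n e / sqrt 2 + N / 2 gives N <= sqrt 2 * n * e. *)
have le_sup : sup E <= n%:R * e / Num.sqrt 2 + sup E / 2.
  apply: ge_sup; first by exists (modulus (block_pair y x)), x.
  by move=> _ [x' bx' <-]; exact: step.
have s2 : Num.sqrt 2 * Num.sqrt 2 = 2 :> R by rewrite -expr2 sqr_sqrtr.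
have s0 : 0 < Num.sqrt 2 :> R by rewrite sqrtr_gt0.
have : modulus (block_pair y x) <= 2 * (n%:R * e / Num.sqrt 2).
  by have := step x bx; lra.
move/le_trans; apply; rewrite -{1}s2 le_eqVlt; apply/orP; left.
by apply/eqP; field; rewrite gt_eqF.
Qed.

End BlockBound.

Section Blocks.
Context {R : realType}.
Local Notation C := R[i].
Variables (n m N : nat) (h : 'I_n * 'I_m -> 'I_N) (k : 'I_N -> 'I_n * 'I_m).
Hypotheses (hK : cancel h k) (kK : cancel k h).

Definition block (x : 'M[C]_N) (a : 'I_n * 'I_n) : 'M[C]_m :=
  \matrix_(i, j) x (h (a.1, i)) (h (a.2, j)).

(** The indices are exchanged because tr(z x) pairs the block (j, i) of x with the block (i, j) of
    z. *)
Definition coblock (z : 'M[C]_N) (a : 'I_n * 'I_n) := block z (a.2, a.1).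

Lemma sum_blocks (V : nmodType) (F : 'I_N -> V) :
  \sum_l F l = \sum_i \sum_j F (h (i, j)).
Proof.
rewrite (reindex h) /=; first exact: sum_prod.
by exists k => l _; [exact: hK | exact: kK].
Qed.

Lemma trace_blocks z x : \tr (z *m x) = block_pair (coblock z) (block x).
Proof.
rewrite /block_pair sum_prod exchange_big /mxtrace sum_blocks.
apply: eq_bigr => i _; transitivity (\sum_j \sum_s \sum_t
    z (h (i, s)) (h (j, t)) * x (h (j, t)) (h (i, s))).
  under eq_bigr do rewrite mxE sum_blocks.
  by rewrite exchange_big.
apply: eq_bigr => j _; apply: eq_bigr => s _.
by rewrite mxE; apply: eq_bigr => t _; rewrite !mxE.
Qed.

Lemma block_adj x a : (block x a)^t* = block (x^t*) (a.2, a.1).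
Proof. by apply/matrixP => i j; rewrite !mxE. Qed.

(** Apply x to e_j (x) v: the components of the image are the x_ij v, so each block column
    contributes at most |v|^2, and there are n of them. *)
Lemma block_contraction x v : contraction x ->
  \sum_a nsq (block x a *m v) <= n%:R * nsq v.
Proof.
move=> cx; pose u j : 'cV[C]_N := \col_l (((k l).1 == j)%:R * v (k l).2 0).
have uE j : nsq (u j) = nsq v.
  rewrite !nsqE sum_blocks (bigD1 j) //= [X in _ + X]big1 ?addr0 => [|i ij].
    by apply: eq_bigr => b _; rewrite mxE hK eqxx mul1r.
  by apply: big1 => b _; rewrite mxE hK (negPf ij) mul0r normr0 expr0n.
have xu j : nsq (x *m u j) = \sum_i nsq (block x (i, j) *m v).
  rewrite nsqE sum_blocks; apply: eq_bigr => i _.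
  rewrite nsqE; apply: eq_bigr => s _; congr (`|_| ^+ 2).
  rewrite !mxE sum_blocks (bigD1 j) //= [X in _ + X]big1 ?addr0 => [|l lj].
    by apply: eq_bigr => t _; rewrite !mxE hK eqxx mul1r.
  by apply: big1 => t _; rewrite mxE hK (negPf lj) mul0r mulr0.
rewrite sum_prod exchange_big /= -(eq_bigr _ (fun j _ => xu j)).
have -> : n%:R * nsq v = \sum_(j < n) nsq v.
  by rewrite sumr_const card_ord mulr_natl.
by apply: ler_sum => j _; rewrite -(uE j).
Qed.

Lemma block_in_ball x : contraction x -> in_ball (block x).
Proof.
move=> cx; split => v; first exact: block_contraction.
under eq_bigr do rewrite block_adj.
rewrite (reindex (fun a : 'I_n * 'I_n => (a.2, a.1))) /=; last first.
  by exists (fun a => (a.2, a.1)) => -[].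
under eq_bigr do rewrite -surjective_pairing.
exact/block_contraction/contraction_adj.
Qed.

End Blocks.

Section TraceNorm.
Context {R : realType}.
Local Notation C := R[i].

(** Polar decomposition: take x = |z|^-1 z^*, with a pseudo-inverse of |z| read off the spectral
    decomposition of z^* z. *)
Lemma trace_norm_attained n (z : 'M[C]_n) :
  exists2 x, contraction x & trace_norm z = complex.Re (\tr (z *m x)).
Proof.
rewrite /trace_norm /absmx; set h := z^t* *m z.
set P := spectralmx h; set D := spectral_diag h.
have PU : P \is unitarymx := spectral_unitarymx h.
have PV : invmx P = P^t* by rewrite invmx_unitary.
have PP : P *m P^t* = 1%:M by apply/unitarymxP.
have hE : h = P^t* *m diag_mx D *m P.
  rewrite -PV; apply/orthomx_spectralP/normalmxP.
  by rewrite /h adjmxM trmxCK.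
have DE : diag_mx D = P *m h *m P^t*.
  by rewrite hE !mulmxA PP mul1mx -mulmxA PP mulmx1.
have D0 i : 0 <= D 0 i.
  have -> : D 0 i = nsq (z *m P^t* *m delta_mx i 0).
    rewrite /nsq dot_adjl mulmxA adjmxM trmxCK.
    rewrite [_ *m (z *m _)](_ : _ = diag_mx D); last by rewrite DE /h !mulmxA.
    rewrite dotE (bigD1 i) //= big1 => [|j ji].
      rewrite mxE eqxx rmorph1 mul1r addr0 mxE (bigD1 i) //= big1 => [|l li].
        by rewrite !mxE !eqxx mulr1 addr0.
      by rewrite [delta_mx _ _ _ _]mxE (negPf li) mulr0.
    by rewrite mxE (negPf ji) rmorph0 mul0r.
  exact: nsq_ge0.
(* Since 0^-1 = 0, this inverts the nonzero eigenvalues and kills the kernel, which also covers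
   singular z. *)
pose F := diag_mx (map_mx (fun d => (sqrtC d)^-1) D).
have FC : F^t* = F.
  rewrite /F tr_diag_mx map_diag_mx; congr diag_mx.
  apply/matrixP => i j; rewrite (ord1 i) !mxE fmorphV; congr (_^-1).
  by apply/CrealP/ger0_real; rewrite sqrtC_ge0.
pose x := P^t* *m F *m P *m z^t*.
exists x; last first.
  rewrite [in RHS]mxtrace_mulC; suff -> : x *m z =
    invmx P *m diag_mx (map_mx sqrtC D) *m P by [].
  rewrite PV /x -mulmxA -/h hE !mulmxA; congr (_ *m _).
  rewrite -[_ *m P *m _]mulmxA PP mulmx1 -mulmxA; congr (_ *m _).
  rewrite /F mulmx_diag; congr diag_mx; apply/matrixP => i j.
  rewrite (ord1 i) !mxE -{2}[D 0 j]sqrtCK expr2.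
  by have [->|d0] := eqVneq (sqrtC (D 0 j)) 0; rewrite ?mulr0 // mulKf.
(* For the adjoint, |x^* v|^2 is the quadratic form at P v of F D F, a diagonal matrix with entries
   0 and 1. *)
rewrite -[x]trmxCK; apply: contraction_adj => v.
have -> : x^t* = z *m (P^t* *m F *m P).
  by rewrite /x !adjmxM !trmxCK FC !mulmxA.
set w := P *m v.
have -> : nsq v = nsq w.
  by rewrite /w /nsq dot_adjl mulmxA -PV mulVmx ?mul1mx ?spectral_unit.
have -> : nsq (z *m (P^t* *m F *m P) *m v) = dot w (F *m diag_mx D *m F *m w).
  have Qv : P^t* *m F *m P *m v = P^t* *m (F *m w) by rewrite /w !mulmxA.
  rewrite /nsq -mulmxA Qv dot_adjl [z^t* *m _]mulmxA -/h hE.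
  have -> : P^t* *m diag_mx D *m P *m (P^t* *m (F *m w))
      = P^t* *m (diag_mx D *m (F *m w)).
    by rewrite !mulmxA -[_ *m P *m P^t*]mulmxA PP mulmx1.
  by rewrite dot_adjl trmxCK mulmxA PP mul1mx dot_adjl FC !mulmxA.
rewrite /F !mulmx_diag dotE nsqE; apply: ler_sum => i _.
rewrite mul_diag_mx !mxE normCK mulrCA [leRHS]mulrC.
rewrite -[leRHS]mul1r; apply: ler_wpM2r; first by rewrite mulrC -normCK exprn_ge0.
rewrite -{2}[D 0 i]sqrtCK expr2.
by have [->|d0] := eqVneq (sqrtC (D 0 i)) 0; rewrite ?mulr0 ?mul0r ?ler01 // mulKf // mulfV.
Qed.

End TraceNorm.

(** * Injective norms *)

Section EpsNorm.
Context {R : realType}.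
Local Notation C := R[i].

Lemma nsq_real n (v : 'cV[C]_n) : nsq v = (\sum_i modulus (v i 0) ^+ 2)%:C%C.
Proof.
rewrite nsqE rmorph_sum; apply: eq_bigr => i _.
by rewrite rmorphXn /= modulusE.
Qed.

Lemma l2norm_le n k (u : 'cV[C]_n) (v : 'cV[C]_k) :
  nsq u <= nsq v -> l2norm u <= l2norm v.
Proof. by rewrite !nsq_real lecR => ?; exact: ler_wsqrtr. Qed.

Lemma opnorm_contraction n (f : 'M[C]_n) : contraction f -> opnorm f <= 1.
Proof.
move=> cf; apply: ge_sup => [|_ [v /= v1 <-]].
  exists (l2norm (f *m 0)), 0 => //=; rewrite /l2norm big1 ?sqrtr0 ?ler01 //.
  by move=> i _; rewrite mxE /modulus normr0 expr0n.
by apply: le_trans v1; apply: l2norm_le.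
Qed.

Lemma modulus_le_l2norm n (v : 'cV[C]_n) i : modulus (v i 0) <= l2norm v.
Proof.
rewrite -[leLHS]ger0_norm ?modulus_ge0 // -sqrtr_sqr ler_wsqrtr //.
by rewrite (bigD1 i) //= lerDl; apply: sumr_ge0 => j _; rewrite sqr_ge0.
Qed.

Lemma entry_le_opnorm n (f : 'M[C]_n) i j : modulus (f i j) <= opnorm f.
Proof.
have -> : f i j = (f *m delta_mx j 0 : 'cV_n) i 0.
  rewrite mxE (bigD1 j) //= big1 => [|k kj].
    by rewrite mxE !eqxx mulr1 addr0.
  by rewrite mxE (negPf kj) mulr0.
apply: le_trans (modulus_le_l2norm _ _) _; apply: ub_le_sup; last first.
  exists (delta_mx j 0) => //=; rewrite /l2norm (bigD1 j) //= big1 => [|k kj].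
    by rewrite mxE !eqxx /modulus normr1 addr0 expr1n sqrtr1.
  by rewrite mxE (negPf kj) /modulus normr0 expr0n.
(* A crude bound showing that the set defining [opnorm] is bounded; otherwise its [sup] need not
   dominate its elements. *)
exists (Num.sqrt (\sum_i (\sum_j modulus (f i j)) ^+ 2)) => _ [v /= v1 <-].
apply: ler_wsqrtr; apply: ler_sum => k _.
have s0 : 0 <= \sum_l modulus (f k l) by apply: sumr_ge0 => l _; exact: modulus_ge0.
rewrite ler_sqr ?nnegrE ?modulus_ge0 // modulus_le mxE.
apply: le_trans (ler_norm_sum _ _ _) _; rewrite rmorph_sum /=; apply: ler_sum => l _.
rewrite normrM -!modulusE -rmorphM lecR -[leRHS]mulr1 ler_wpM2l ?modulus_ge0 //.
exact: le_trans (modulus_le_l2norm v l) v1.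
Qed.

Section Tensor.
Variables (m n : nat) (z : 'M[C]_(m * n)).

(** Ensures that the suprema defining [eps_norm] and [eps_norm_sa] are over bounded sets. *)
Lemma modulus_tens_bound f g : opnorm f <= 1 -> opnorm g <= 1 ->
  modulus (\tr (z *m (f *t g))) <= \sum_k \sum_l modulus (z k l).
Proof.
move=> f1 g1; rewrite modulus_le /mxtrace rmorph_sum.
apply: le_trans (ler_norm_sum _ _ _) _; apply: ler_sum => k _.
rewrite mxE rmorph_sum; apply: le_trans (ler_norm_sum _ _ _) _.
apply: ler_sum => l _; rewrite mxE !normrM -!modulusE -!rmorphM lecR.
rewrite -[leRHS]mulr1 ler_wpM2l ?modulus_ge0 // -[leRHS]mulr1.
by rewrite ler_pM ?modulus_ge0 // (le_trans (entry_le_opnorm _ _ _)).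
Qed.

Lemma eps_norm_ge f g : contraction f -> contraction g ->
  modulus (\tr (z *m (f *t g))) <= eps_norm z.
Proof.
move=> cf cg; apply: ub_le_sup.
  exists (\sum_k \sum_l modulus (z k l)) => _ [f' /= f1 [g' /= g1 <-]].
  exact: modulus_tens_bound.
by exists f; [exact: opnorm_contraction|exists g => //; exact: opnorm_contraction].
Qed.

Lemma eps_norm_sa_ge f g : f \is hermsymmx -> g \is hermsymmx ->
  contraction f -> contraction g ->
  modulus (\tr (z *m (f *t g))) <= eps_norm_sa z.
Proof.
move=> hf hg cf cg; apply: ub_le_sup.
  exists (\sum_k \sum_l modulus (z k l)) => _ [f' /= [_ f1] [g' /= [_ g1] <-]].
  exact: modulus_tens_bound.
exists f; first by split => //; exact: opnorm_contraction.
by exists g => //; split => //; exact: opnorm_contraction.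
Qed.

End Tensor.

Lemma hermsymmxE n (f : 'M[C]_n) : (f \is hermsymmx) = (f == f^t*).
Proof. by rewrite is_hermitianmxE expr0 scale1r. Qed.

(** By the parallelogram identity. It applies to real and imaginary parts. *)
Lemma contraction_mean n (f g : 'M[C]_n) (c : C) : `|c| = 2^-1 ->
  contraction f -> contraction g -> contraction (c *: (f + g)).
Proof.
move=> c2 cf cg v; rewrite -scalemxAl mulmxDl nsqZ c2 exprVn mulrC.
rewrite ler_pdivrMr ?exprn_gt0 //.
have := nsq_ge0 (f *m v - g *m v).
have -> : nsq (f *m v - g *m v)
    = 2 * nsq (f *m v) + 2 * nsq (g *m v) - nsq (f *m v + g *m v).
  by rewrite nsqB nsqD; ring.
rewrite subr_ge0 => /le_trans; apply.
have -> : nsq v * 2 ^+ 2 = 2 * nsq v + 2 * nsq v by ring.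
by apply: lerD; rewrite ler_pM2l ?cf ?cg.
Qed.

Lemma contractionN n (f : 'M[C]_n) : contraction f -> contraction (- f).
Proof. by move=> cf v; rewrite mulNmx -scaleN1r nsqZ normrN1 expr1n mul1r. Qed.

Lemma tensmxDl m n (f f' : 'M[C]_m) (g : 'M[C]_n) :
  (f + f') *t g = f *t g + f' *t g.
Proof. by apply/matrixP => i j; rewrite !mxE mulrDl. Qed.

Lemma tensmxDr m n (f : 'M[C]_m) (g g' : 'M[C]_n) :
  f *t (g + g') = f *t g + f *t g'.
Proof. by apply/matrixP => i j; rewrite !mxE mulrDr. Qed.

Lemma tensmxZl m n (f : 'M[C]_m) (g : 'M[C]_n) c : (c *: f) *t g = c *: (f *t g).
Proof. by apply/matrixP => i j; rewrite !mxE mulrA. Qed.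

Lemma tensmxZr m n (f : 'M[C]_m) (g : 'M[C]_n) c : f *t (c *: g) = c *: (f *t g).
Proof. by apply/matrixP => i j; rewrite !mxE mulrCA. Qed.

Lemma tensmx_adj m n (f : 'M[C]_m) (g : 'M[C]_n) : (f *t g)^t* = f^t* *t g^t*.
Proof. by rewrite trmx_tens map_mxT. Qed.

Lemma modulusB_le (a b : C) : modulus (a - b) <= modulus a + modulus b.
Proof. by rewrite modulus_le rmorphD /= !modulusE ler_normB. Qed.

Lemma real_part_split (a b c d : C) :
  (a + d) / 2 = 2^-1 * (2^-1 * (a + b + (c + d)))
    - 'i / 2 * ('i / 2 * (a - b + (- c - - d))).
Proof.
have i2 : 'i * 'i = -1 :> C by rewrite -expr2 sqrCi.
transitivity (2^-1 * (2^-1 * (a + b + (c + d)))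
  - 'i * 'i / 4 * (a - b - (c - d))); last by field.
by rewrite i2; field.
Qed.

(* With f = f1 + i f2 and g = g1 + i g2, the real part of z(f, g) is
   z(f1, g1) - z(f2, g2). *)
Lemma eps_norm_complexify m n (z : 'M[C]_(m * n)) f g : z \is hermsymmx ->
  contraction f -> contraction g ->
  modulus (\tr (z *m (f *t g))) <= 2 * eps_norm_sa z.
Proof.
rewrite hermsymmxE => /eqP zH cf cg.
pose Z f g := \tr (z *m (f *t g)).
have ZDl a b c : Z (a + b) c = Z a c + Z b c.
  by rewrite /Z tensmxDl mulmxDr mxtraceD.
have ZDr a b c : Z c (a + b) = Z c a + Z c b.
  by rewrite /Z tensmxDr mulmxDr mxtraceD.
have ZZl k a b : Z (k *: a) b = k * Z a b.
  by rewrite /Z tensmxZl -scalemxAr mxtraceZ.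
have ZZr k a b : Z a (k *: b) = k * Z a b.
  by rewrite /Z tensmxZr -scalemxAr mxtraceZ.
have ZNl a b : Z (- a) b = - Z a b by rewrite -scaleN1r ZZl mulN1r.
have ZNr a b : Z a (- b) = - Z a b by rewrite -scaleN1r ZZr mulN1r.
have Zconj f' g' : Z (f'^t*) (g'^t*) = (Z f' g')^*.
  rewrite /Z -tensmx_adj mxtrace_mulC {1}zH -adjmxM /mxtrace rmorph_sum.
  by apply: eq_bigr => i _; rewrite !mxE.
pose re k (A : 'M[C]_k) := 2^-1 *: (A + A^t*).
(* This is minus the imaginary part; the sign cancels because both arguments carry it. *)
pose im k (A : 'M[C]_k) := ('i / 2) *: (A - A^t*).
have adjD k (A B : 'M[C]_k) : (A + B)^t* = A^t* + B^t* by rewrite linearD map_mxD.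
have adjN k (A : 'M[C]_k) : (- A)^t* = - A^t* by rewrite linearN map_mxN.
have adjZ k (A : 'M[C]_k) c : (c *: A)^t* = c^* *: A^t*.
  by rewrite linearZ map_mxZ.
have n2 : `|2^-1| = 2^-1 :> C by rewrite normfV normr_nat.
have ni : `|('i / 2)| = 2^-1 :> C by rewrite normrM n2 normCi mul1r.
have reH k A : @re k A \is hermsymmx.
  by rewrite hermsymmxE /re adjZ adjD trmxCK fmorphV /= conjC_nat addrC.
have imH k A : @im k A \is hermsymmx.
  rewrite hermsymmxE /im adjZ adjD adjN trmxCK rmorphM /= fmorphV /= conjC_nat conjCi.
  by rewrite -[A^t* - A]opprB scalerN mulNr scaleNr opprK.
have reC k A : contraction A -> contraction (@re k A).
  by move=> cA; exact: contraction_mean n2 cA (contraction_adj cA).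
have imC k A : contraction A -> contraction (@im k A).
  by move=> cA; exact: contraction_mean ni cA (contractionN (contraction_adj cA)).
rewrite -/(Z f g); have [->|a0] := eqVneq (Z f g) 0.
  rewrite /modulus normr0 mulr_ge0 //.
  apply: le_trans (eps_norm_sa_ge z (reH _ f) (reH _ g) (reC _ _ cf) (reC _ _ cg)).
  exact: modulus_ge0.
(* Rotating f by a phase makes the value equal to its modulus, so only its real part has to be
   bounded. *)
pose t := (Z f g)^* / `|Z f g|; pose f' := t *: f.
have nt : `|t| = 1.
  by rewrite /t normrM norm_conjC normfV normr_id mulfV // normr_eq0.
have cf' : contraction f' by move=> v; rewrite -scalemxAl nsqZ nt expr1n mul1r.
have Zf' : Z f' g = `|Z f g|.
  rewrite ZZl /t mulrAC [_^* * _]mulrC.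
  by rewrite -normCK expr2 mulfK // normr_eq0.
clearbody f'; have split_re : Z f' g = Z (re _ f') (re _ g) - Z (im _ f') (im _ g).
  have -> : Z f' g = (Z f' g + Z (f'^t*) (g^t*)) / 2.
    by rewrite Zconj Zf' (CrealP (normr_real _)); field.
  rewrite /re /im ZZl ZZr ZDl !ZDr ZZl ZZr ZDl !ZDr !ZNl !ZNr.
  exact: real_part_split.
have -> : modulus (Z f g) = modulus (Z f' g) by rewrite /modulus Zf' normr_id.
rewrite split_re; apply: le_trans (modulusB_le _ _) _.
rewrite mulr_natl mulr2n; apply: lerD.
  exact: eps_norm_sa_ge (reH _ _) (reH _ _) (reC _ _ cf') (reC _ _ cg).
exact: eps_norm_sa_ge (imH _ _) (imH _ _) (imC _ _ cf') (imC _ _ cg).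
Qed.

End EpsNorm.

(** * Cutting along the smaller tensor factor *)

Section Main.
Context {R : realType}.
Local Notation C := R[i].

Lemma trace_norm_le m n (z : 'M[C]_(m * n)) (e : R) : (0 < m)%N -> (0 < n)%N ->
  (forall f g, contraction f -> contraction g ->
     modulus (\tr (z *m (f *t g))) <= e) ->
  trace_norm z <= Num.sqrt 2 * (minn m n)%:R * e.
Proof.
move=> m0 n0 bound; have [x cx ->] := trace_norm_attained z.
apply: le_trans (Re_le_modulus _) _.
case: (leqP m n) => _.
  pose h (a : 'I_m * 'I_n) := mxtens_index a.
  have hK : cancel h (@mxtens_unindex m n) := @mxtens_indexK m n.
  have kK : cancel (@mxtens_unindex m n) h := @mxtens_unindexK m n.
  rewrite (trace_blocks hK kK); apply: block_pair_le => //.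
    exact: (block_in_ball hK kK).
  move=> f g cf cg; have := bound f g cf cg; rewrite (trace_blocks hK kK).
  rewrite (_ : block h (f *t g) = fun a => f a.1 a.2 *: g) //.
  by apply/funext => a; apply/matrixP => i j; rewrite mxE tensmxE mxE.
(* The second factor is now the smaller one, so the two tensor factors exchange roles. *)
pose h (a : 'I_n * 'I_m) := mxtens_index (a.2, a.1).
pose k (l : 'I_(m * n)) := let a := mxtens_unindex l in (a.2, a.1).
have hK : cancel h k by move=> [i j]; rewrite /h /k mxtens_indexK.
have kK : cancel k h by move=> l; rewrite /h /k -surjective_pairing mxtens_unindexK.
rewrite (trace_blocks hK kK); apply: block_pair_le => //.
  exact: (block_in_ball hK kK).
move=> g f cg cf; have := bound f g cf cg; rewrite (trace_blocks hK kK).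
rewrite (_ : block h (f *t g) = fun a => g a.1 a.2 *: f) //.
by apply/funext => a; apply/matrixP => i j; rewrite mxE tensmxE mxE mulrC.
Qed.

End Main.

Theorem proposition2p3 (R : realType) (nA nB : nat)
    (nA_ge1 : (1 <= nA)%N) (nB_ge1 : (1 <= nB)%N) :
  (forall z : 'M[R[i]]_(nA * nB),
     trace_norm z <= 2 * (minn nA nB)%:R * eps_norm z) /\
  (forall z : 'M[R[i]]_(nA * nB), z \is hermsymmx ->
     trace_norm z <= 2 * Num.sqrt 2 * (minn nA nB)%:R * eps_norm_sa z).
Proof.
split=> [z|z zH]; last first.
  have -> : 2 * Num.sqrt 2 * (minn nA nB)%:R * eps_norm_sa z
      = Num.sqrt 2 * (minn nA nB)%:R * (2 * eps_norm_sa z) by ring.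
  apply: (trace_norm_le nA_ge1 nB_ge1) => f g; exact: eps_norm_complexify.
apply: le_trans (trace_norm_le nA_ge1 nB_ge1 (@eps_norm_ge _ _ _ z)) _.
have eps0 : 0 <= eps_norm z.
  apply: le_trans (modulus_ge0 _) (eps_norm_ge z _ _); exact: contraction0.
(* It remains to weaken the constant, by sqrt 2 <= 2. *)
rewrite -!mulrA ler_wpM2r ?mulr_ge0 // -[leRHS]ger0_norm // -sqrtr_sqr.
by rewrite ler_wsqrtr // expr2 ler_peMl // ler1n.
Qed.
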